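(* Let $n\ge1$, $d\ge1$. Let $A_1,\dots,A_n:\mathbb{R}^d\rightrightarrows\mathbb{R}^d$ be maximal monotone and $B:\mathbb{R}^d\to\mathbb{R}^d$ monotone and $L$-Lipschitz ($L>0$), and assume $0\in\sum_{i=1}^nA_i(z)+B(z)$ has a solution. Fix a total number of iterations $K\ge1$ and a constant $C_f>0$, and run Algorithm SPS (described in the context) for $k=1,\dots,K$ with $\tau>0$, an initial point $p^1=(z^1,w_1^1,\dots,w_{n+1}^1)$ with $\sum_{i=1}^{n+1}w_i^1=0$, and constant stepsizes $$\rho_k=\rho:=\min\Big\{K^{-1/4},\frac{1}{2L}\Big\},\qquad \alpha_k=C_f\rho^2,\qquad k=1,\dots,K.$$ Suppose that almost surely for every $k$, $\mathbb{E}[\epsilon^k\mid\mathcal{F}_k]=0$, $\mathbb{E}[e^k\mid\mathcal{F}_k]=0$, $\mathbb{E}[\|\epsilon^k\|^2\mid\mathcal{F}_k]\le N_1+N_2\|B(z^k)\|^2$ and $\mathbb{E}[\|e^k\|^2\mid\mathcal{F}_k,\mathcal{E}_k]\le N_3+N_4\|B(x_{n+1}^k)\|^2$ for constants $0\le N_1,\dots,N_4<\infty$. Define $$O_k=\sum_{i=1}^n\|y_i^k-w_i^k\|^2+\sum_{i=1}^n\|z^k-x_i^k\|^2+\|B(z^k)-w_{n+1}^k\|^2.$$ Then $$\frac1K\sum_{j=1}^K\mathbb{E}[O_j]=O(K^{-1/4}),$$ where the constant hidden in $O(\cdot)$ does not depend on $K$ (it depends only on $n,\tau,L,N_1,\dots,N_4,C_f$,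 the initial point $p^1$, and the problem data).
   Context: For maximal monotone $A$ and $\tau>0$, $J_{\tau A}=(I+\tau A)^{-1}$ (single-valued, domain $\mathbb{R}^d$). Algorithm SPS: given $p^k=(z^k,w_1^k,\dots,w_{n+1}^k)$, for $i=1,\dots,n$ set $t_i^k=z^k+\tau w_i^k$, $x_i^k=J_{\tau A_i}(t_i^k)$, $y_i^k=\tau^{-1}(t_i^k-x_i^k)$; then $r^k=B(z^k)+\epsilon^k$, $x_{n+1}^k=z^k-\rho_k(r^k-w_{n+1}^k)$, $y_{n+1}^k=B(x_{n+1}^k)+e^k$, where $\epsilon^k,e^k$ are $\mathbb{R}^d$-valued random noise variables on a probability space; finally $z^{k+1}=z^k-\alpha_k\sum_{i=1}^{n+1}y_i^k$ and $w_i^{k+1}=w_i^k-\alpha_k(x_i^k-\frac1{n+1}\sum_{j=1}^{n+1}x_j^k)$, $i=1,\dots,n+1$. $\mathcal{F}_k=\sigma(p^1,\dots,p^k)$, $\mathcal{E}_k=\sigma(\epsilon^k)$. *)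

(* Defs.v *)
From HB Require Import structures.
From mathcomp Require Import all_boot all_order all_algebra.
From mathcomp Require Import all_classical all_reals all_analysis.
Set Implicit Arguments. Unset Strict Implicit. Unset Printing Implicit Defensive.
Import Order.TTheory GRing.Theory Num.Theory.
Local Open Scope classical_set_scope.
Local Open Scope ring_scope.

(* Vectors of R^d are row vectors 'rV[R]_d, with the EUCLIDEAN inner product
   and norm (the library's default norm on matrices is the max norm). *)
Definition dotv (R : realType) (d : nat) (u v : 'rV[R]_d) : R :=
  \sum_(j < d) u ord0 j * v ord0 j.
Definition sqnorm (R : realType) (d : nat) (u : 'rV[R]_d) : R := dotv u u.
Definition enorm (R : realType) (d : nat) (u : 'rV[R]_d) : R := Num.sqrt (sqnorm u).

Definition monotone_op (R : realType) (d : nat) (A : 'rV[R]_d -> set 'rV[R]_d) :=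
  forall x y u v, A x u -> A y v -> 0 <= dotv (x - y) (u - v).

Definition maximal_monotone (R : realType) (d : nat) (A : 'rV[R]_d -> set 'rV[R]_d) :=
  monotone_op A /\
  forall A' : 'rV[R]_d -> set 'rV[R]_d, monotone_op A' ->
    (forall x, A x `<=` A' x) -> forall x, A' x = A x.

Definition monotone_fun (R : realType) (d : nat) (B : 'rV[R]_d -> 'rV[R]_d) :=
  forall x y, 0 <= dotv (x - y) (B x - B y).

Definition lipschitz_fun (R : realType) (d : nat) (B : 'rV[R]_d -> 'rV[R]_d) (L : R) :=
  forall x y, enorm (B x - B y) <= L * enorm (x - y).

Definition preimage_sets (T : Type) (R : realType) (fs : set (T -> R)) : set (set T) :=
  [set G | exists f U, fs f /\ measurable U /\ G = f @^-1` U].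
Definition gen_sigma (T : Type) (R : realType) (fs : set (T -> R)) : set (set T) :=
  <<s preimage_sets fs >>.

Definition coords (T : Type) (R : realType) (d : nat) (X : T -> 'rV[R]_d) : set (T -> R) :=
  [set f | exists l : 'I_d, f = fun om => X om ord0 l].

Definition Fk_gens (T : Type) (R : realType) (d n : nat)
  (z : nat -> T -> 'rV[R]_d) (w : nat -> 'I_n.+1 -> T -> 'rV[R]_d) (k : nat) : set (T -> R) :=
  [set f | exists j, (1 <= j <= k)%N /\ (coords (z j) f \/ exists i, coords (w j i) f)].
Definition Fk (T : Type) (R : realType) (d n : nat)
  (z : nat -> T -> 'rV[R]_d) (w : nat -> 'I_n.+1 -> T -> 'rV[R]_d) (k : nat) : set (set T) :=
  gen_sigma (Fk_gens z w k).
Definition FEk (T : Type) (R : realType) (d n : nat)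
  (z : nat -> T -> 'rV[R]_d) (w : nat -> 'I_n.+1 -> T -> 'rV[R]_d)
  (eps : nat -> T -> 'rV[R]_d) (k : nat) : set (set T) :=
  gen_sigma (Fk_gens z w k `|` coords (eps k)).

(* Conditional expectations (not in the library), through their defining
   property w.r.t. a sub-sigma-algebra F:
   E[X | F] = 0 a.s.  :<=>  X integrable and  E[X 1_G] = 0 for all G in F. *)
Definition cond_exp_zero (dm : measure_display) (T : measurableType dm) (R : realType)
  (P : probability T R) (F : set (set T)) (X : T -> R) : Prop :=
  P.-integrable setT (EFin \o X) /\
  forall G, F G -> (\int[P]_(om in G) (X om)%:E = 0)%E.
(* For X >= 0 and an F-measurable Y >= 0:
   E[X | F] <= Y a.s.  :<=>  E[X 1_G] <= E[Y 1_G] for all G in F. *)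
Definition cond_exp_le (dm : measure_display) (T : measurableType dm) (R : realType)
  (P : probability T R) (F : set (set T)) (X Y : T -> R) : Prop :=
  forall G, F G -> (\int[P]_(om in G) (X om)%:E <= \int[P]_(om in G) (Y om)%:E)%E.

Definition rho_step (R : realType) (K : nat) (L : R) : R :=
  Num.min (K%:R `^ (- 4^-1)) (2 * L)^-1.

(* Main.v *)
Require Import Defs.
From HB Require Import structures.
From mathcomp Require Import all_boot all_order all_algebra.
From mathcomp Require Import all_classical all_reals all_analysis.
From mathcomp Require Import measurable_realfun ring lra.
Import Order.TTheory GRing.Theory Num.Theory.
Local Open Scope classical_set_scope.
Local Open Scope ring_scope.
Set Implicit Arguments.
Unset Strict Implicit.
Unset Printing Implicit Defensive.

(* Let V_k = |z^k - zs|^2 + sum_i |w_i^k - ws_i|^2, where zs is a solution, ws_i in A_i(zs)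
   for i <= n and ws_{n+1} = B(zs).  The iteration is a subgradient step on the affine function
   sum_i <z - x_i, y_i - w_i>, so V_{k+1} - V_k is -2 alpha times
   sum_i (<z - x_i, y_i - w_i> + <x_i - zs, y_i - ws_i>) plus alpha^2 times a squared norm.
   By monotonicity that sum is at least c rho O_k - rho^2 L |eps|^2 + <e, z^k - zs> plus a
   multiple of <eps, B z - w_{n+1}>,
   and the squared norm is at most C (1 + V_k + |eps|^2 + |e|^2).  The noise e enters linearly
   only through <e, z^k - zs>, so both linear noise terms have mean zero given F_k, although e
   need not be centered given eps.  Since alpha = Cf rho^2 and rho^4 <= 1/K, taking expectations
   gives E V_{k+1} + 2 Cf c rho^3 E O_k <= E V_k + (G / K) (1 + E V_k): E V_k stays bounded for
   k <= K, and summing yields (1/K) sum_k E O_k = O(1 / (K rho^3)) = O(K^{-1/4}). *)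

(** * Euclidean inner product and squared norm *)

Lemma dotvC (R : realType) d (u v : 'rV[R]_d) : dotv u v = dotv v u.
Proof. by apply: eq_bigr => j _; rewrite mulrC. Qed.

Lemma dotvDl (R : realType) d (u v w : 'rV[R]_d) :
  dotv (u + v) w = dotv u w + dotv v w.
Proof. by rewrite /dotv -big_split; apply: eq_bigr => j _; rewrite mxE mulrDl. Qed.

Lemma dotvZl (R : realType) d (c : R) (u v : 'rV[R]_d) :
  dotv (c *: u) v = c * dotv u v.
Proof. by rewrite /dotv mulr_sumr; apply: eq_bigr => j _; rewrite mxE mulrA. Qed.

Lemma dotvNl (R : realType) d (u v : 'rV[R]_d) : dotv (- u) v = - dotv u v.
Proof. by rewrite -scaleN1r dotvZl mulN1r. Qed.

Lemma dotvDr (R : realType) d (u v w : 'rV[R]_d) :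
  dotv w (u + v) = dotv w u + dotv w v.
Proof. by rewrite dotvC dotvDl !(dotvC w). Qed.

Lemma dotvZr (R : realType) d (c : R) (u v : 'rV[R]_d) :
  dotv v (c *: u) = c * dotv v u.
Proof. by rewrite dotvC dotvZl dotvC. Qed.

Lemma dotvNr (R : realType) d (u v : 'rV[R]_d) : dotv v (- u) = - dotv v u.
Proof. by rewrite dotvC dotvNl dotvC. Qed.

Lemma dotv0r (R : realType) d (u : 'rV[R]_d) : dotv u 0 = 0.
Proof. by rewrite /dotv big1 // => j _; rewrite mxE mulr0. Qed.

Lemma dotv_sumr (R : realType) d (I : finType) (u : I -> 'rV[R]_d) v :
  dotv v (\sum_i u i) = \sum_i dotv v (u i).
Proof. exact: (big_morph (dotv v) (fun x y => dotvDr x y v) (dotv0r v)). Qed.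

Definition dotvE := (dotvDl, dotvDr, dotvNl, dotvNr, dotvZl, dotvZr).

Lemma sqnorm_ge0 (R : realType) d (u : 'rV[R]_d) : 0 <= sqnorm u.
Proof. by apply: sumr_ge0 => j _; rewrite -expr2 sqr_ge0. Qed.

Lemma sqnormZ (R : realType) d (c : R) (u : 'rV[R]_d) :
  sqnorm (c *: u) = c ^+ 2 * sqnorm u.
Proof. by rewrite /sqnorm !dotvE expr2 mulrA. Qed.

Lemma sqnormN (R : realType) d (u : 'rV[R]_d) : sqnorm (- u) = sqnorm u.
Proof. by rewrite /sqnorm !dotvE opprK. Qed.

Lemma sqnormD_le (R : realType) d (u v : 'rV[R]_d) :
  sqnorm (u + v) <= 2 * sqnorm u + 2 * sqnorm v.
Proof.
by have := sqnorm_ge0 (u - v); rewrite /sqnorm !dotvE (dotvC v u); lra.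
Qed.

Lemma sqnormB_le (R : realType) d (u v : 'rV[R]_d) :
  sqnorm (u - v) <= 2 * sqnorm u + 2 * sqnorm v.
Proof. by rewrite -(sqnormN v) sqnormD_le. Qed.

(** Lagrange's identity: the difference of the two sides is half the double sum of
    [sqnorm (u i - u j)], which is nonnegative. *)
Lemma sqnorm_sum_le (R : realType) d n (u : 'I_n -> 'rV[R]_d) :
  sqnorm (\sum_i u i) <= n%:R * \sum_i sqnorm (u i).
Proof.
suff -> : n%:R * \sum_i sqnorm (u i)
  = sqnorm (\sum_i u i) + 2^-1 * \sum_i \sum_j sqnorm (u i - u j).
  by rewrite lerDl mulr_ge0 ?invr_ge0// sumr_ge0// => i _;
     apply: sumr_ge0 => j _; exact: sqnorm_ge0.
have E i j : sqnorm (u i - u j) = sqnorm (u i) + sqnorm (u j) - 2 * dotv (u i) (u j).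
  by rewrite /sqnorm !dotvE (dotvC (u j)); ring.
have -> : sqnorm (\sum_i u i) = \sum_i \sum_j dotv (u i) (u j).
  rewrite /sqnorm dotv_sumr; apply: eq_bigr => i _.
  by rewrite dotvC dotv_sumr.
under [X in _ + _ * X]eq_bigr do under eq_bigr do rewrite E.
under [X in _ + _ * X]eq_bigr do
  rewrite sumrB big_split/= -mulr_sumr sumr_const card_ord -[_ *+ n]mulr_natl.
rewrite sumrB big_split/= -!mulr_sumr sumr_const card_ord -[_ *+ n]mulr_natl.
by field.
Qed.

(** The mean m minimizes the sum of squared distances: splitting [u i - v] at m, the cross terms add
    up to zero because the deviations from m do. *)
Lemma sqnorm_center_le (R : realType) d n (u : 'I_n.+1 -> 'rV[R]_d) (v : 'rV[R]_d) :
  \sum_i sqnorm (u i - (n.+1)%:R^-1 *: \sum_j u j) <= \sum_i sqnorm (u i - v).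
Proof.
set m := _ *: _.
have cm : \sum_i (u i - m) = 0.
  rewrite sumrB sumr_const card_ord /m -scaler_nat scalerA divff ?pnatr_eq0//.
  by rewrite scale1r subrr.
have -> : \sum_i sqnorm (u i - v)
        = \sum_i (sqnorm (u i - m) + (sqnorm (m - v) + 2 * dotv (m - v) (u i - m))).
  apply: eq_bigr => i _; have -> : u i - v = (u i - m) + (m - v) by rewrite addrA subrK.
  rewrite /sqnorm; move: (u i - m) (m - v) => p q.
  by rewrite !dotvE (dotvC q p); ring.
rewrite big_split/= lerDl big_split/= -mulr_sumr -(dotv_sumr (fun i => u i - m)).
rewrite cm dotv0r mulr0 addr0.
by apply: sumr_ge0 => i _; exact: sqnorm_ge0.
Qed.

(** * Monotone and Lipschitz operators, backward and forward steps *)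

Lemma lipschitz_sqnorm (R : realType) d (B : 'rV[R]_d -> 'rV[R]_d) (L : R) :
  0 < L -> lipschitz_fun B L ->
  forall u v, sqnorm (B u - B v) <= L ^+ 2 * sqnorm (u - v).
Proof.
move=> L0 BL u v; have := BL u v.
rewrite -(@ler_pXn2r _ 2)// ?nnegrE ?mulr_ge0 ?sqrtr_ge0 ?(ltW L0)//.
by rewrite exprMn !sqr_sqrtr ?sqnorm_ge0.
Qed.

(** In the expanded square, monotonicity makes the cross term [2 * tau * dotv (x - y) (u - v)]
    nonnegative. Points of the graph stand for values of the resolvent: x is the resolvent of
    [x + tau *: u]. *)
Lemma resolvent_nonexpansive (R : realType) d (A : 'rV[R]_d -> set 'rV[R]_d)
    (tau : R) x y u v : 0 < tau -> monotone_op A -> A x u -> A y v ->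
  sqnorm (x - y) + tau ^+ 2 * sqnorm (u - v)
    <= sqnorm ((x + tau *: u) - (y + tau *: v)).
Proof.
move=> t0 mA Au Av.
have -> : (x + tau *: u) - (y + tau *: v) = (x - y) + tau *: (u - v).
  by rewrite scalerBr opprD addrACA.
have := mulr_ge0 (ltW t0) (mA _ _ _ _ Au Av).
rewrite -sqnormZ /sqnorm; move: (x - y) (u - v) => p q.
by rewrite !dotvE (dotvC q p); nra.
Qed.

(** Nonexpansiveness is applied against the solution, which is its own backward step: [zs] is the
    resolvent of [zs + tau *: a]. *)
Lemma backward_step_bound (R : realType) d (A : 'rV[R]_d -> set 'rV[R]_d)
    (tau : R) z w x y zs a : 0 < tau -> monotone_op A -> A x y -> A zs a ->
    z + tau *: w = x + tau *: y ->
  sqnorm (x - zs) + tau ^+ 2 * sqnorm (y - a)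
    <= 2 * sqnorm (z - zs) + 2 * (tau ^+ 2 * sqnorm (w - a)).
Proof.
move=> t0 mA Axy Aza E; apply: le_trans (resolvent_nonexpansive t0 mA Axy Aza) _.
rewrite -E -sqnormZ scalerBr.
have -> : z + tau *: w - (zs + tau *: a) = (z - zs) + (tau *: w - tau *: a).
  by rewrite opprD addrACA.
exact: sqnormD_le.
Qed.

(** Since [z - x = tau *: (y - w)], the product is a multiple of either squared norm. Half of each
    is kept, so that both backward sums of O_k show up in the decrease. *)
Lemma backward_step_gap (R : realType) d (tau : R) (z w x y : 'rV[R]_d) : 0 < tau ->
  z + tau *: w = x + tau *: y ->
  dotv (z - x) (y - w) = (2 * tau)^-1 * sqnorm (z - x) + tau / 2 * sqnorm (y - w).
Proof.
move=> t0 E; have -> : z - x = tau *: (y - w).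
  rewrite scalerBr; apply/eqP; rewrite subr_eq addrAC eq_sym subr_eq.
  by rewrite addrC -E.
by rewrite sqnormZ !dotvE /sqnorm !dotvE; field; rewrite gt_eqF.
Qed.

(** Put b = B z - w, h = B x - B z, g = b + eps and s = rho L, so that z - x = rho g and the gap is
    rho <g, b + h>. The Lipschitz bound |h| <= s |g| and Young's inequality give <g, h> >= - s
    |g|^2. The product <eps, b> is never estimated: its coefficient stays exact so that it can
    vanish in expectation. *)
Lemma forward_step_gap (R : realType) d (B : 'rV[R]_d -> 'rV[R]_d) (L rho : R) z w x eps :
  0 < L -> lipschitz_fun B L -> 0 < rho ->
  x = z - rho *: (B z + eps - w) ->
  rho * ((1 - rho * L) * sqnorm (B z - w) + (1 - 2 * (rho * L)) * dotv eps (B z - w)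
         - rho * L * sqnorm eps)
    <= dotv (z - x) (B x - w).
Proof.
move=> L0 BL r0 xE; have s0 : 0 < rho * L by rewrite mulr_gt0.
have -> : z - x = rho *: ((B z - w) + eps).
  by rewrite xE opprD addrA subrr add0r opprK; congr (_ *: _); rewrite addrAC.
have := lipschitz_sqnorm L0 BL x z.
have -> : x - z = - (rho *: ((B z - w) + eps)).
  by rewrite xE addrAC subrr add0r; congr (- (_ *: _)); rewrite addrAC.
have -> : B x - w = (B z - w) + (B x - B z) by rewrite [RHS]addrC addrA subrK.
rewrite sqnormN sqnormZ; move: (B z - w) (B x - B z) => b h.
rewrite dotvZl ler_pM2l // => hb.
(* Young's inequality as a completed square, weighted so that both squares cost s |g|^2. *)
have : 0 <= (rho * L)^-1 * sqnorm ((rho * L) *: (b + eps) + h).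
  by rewrite mulr_ge0 ?invr_ge0 ?(ltW s0) ?sqnorm_ge0.
have {}hb : (rho * L)^-1 * sqnorm h <= rho * L * sqnorm (b + eps).
  by rewrite ler_pdivrMl// (le_trans hb)//; move: (sqnorm _) => q; lra.
have -> : (rho * L)^-1 * sqnorm ((rho * L) *: (b + eps) + h)
   = (rho * L)* sqnorm (b + eps) + 2 * dotv (b + eps) h + (rho * L)^-1 * sqnorm h.
  rewrite /sqnorm; move: (b + eps) (rho * L) s0 => g s s0.
  by rewrite !dotvE (dotvC h g); field; rewrite gt_eqF.
have -> : dotv (b + eps) (b + h) = sqnorm b + dotv eps b + dotv (b + eps) h.
  by rewrite /sqnorm !dotvE; ring.
have E : sqnorm (b + eps) = sqnorm b + 2 * dotv eps b + sqnorm eps.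
  by rewrite /sqnorm !dotvE (dotvC b eps); ring.
move: hb; rewrite E; move: (rho * L) (dotv (b + eps) h) => s t; nra.
Qed.

(** * The energy and its exact change under one update *)

Lemma sum_ord_max (R : realType) n (F : 'I_n.+1 -> R) :
  \sum_i F i = \sum_(i < n.+1 | (i < n)%N) F i + F ord_max.
Proof.
rewrite (bigD1 ord_max)//= addrC; congr (_ + _); apply: eq_bigl => i.
by rewrite -val_eqE/= ltn_neqAle -ltnS ltn_ord andbT.
Qed.

Definition energy (R : realType) d n (zs : 'rV[R]_d) (ws : 'I_n.+1 -> 'rV[R]_d)
    (z : 'rV[R]_d) (w : 'I_n.+1 -> 'rV[R]_d) : R :=
  sqnorm (z - zs) + \sum_i sqnorm (w i - ws i).

Lemma sqnorm_le_energy (R : realType) d n zs (ws : 'I_n.+1 -> 'rV[R]_d) z w i :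
  sqnorm (z - zs) + sqnorm (w i - ws i) <= energy zs ws z w.
Proof.
rewrite lerD2l (bigD1 i)//= lerDl; apply: sumr_ge0 => j _; exact: sqnorm_ge0.
Qed.

Lemma energy_ge0 (R : realType) d n zs (ws : 'I_n.+1 -> 'rV[R]_d) z w :
  0 <= energy zs ws z w.
Proof.
by rewrite addr_ge0 ?sqnorm_ge0// sumr_ge0// => i _; rewrite sqnorm_ge0.
Qed.

(** Expanding the squares leaves the linear terms <z - zs, sum_i y_i> + sum_i <w_i - ws_i, x_i -
    xb>. They differ from the sum of gaps only by inner products with sum_i w_i and sum_i ws_i, both
    zero; this works for every common vector [xb]. *)
Lemma energy_step (R : realType) d n zs (ws : 'I_n.+1 -> 'rV[R]_d) z
    (w x y : 'I_n.+1 -> 'rV[R]_d) (xb : 'rV[R]_d) (alpha : R) :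
  \sum_i w i = 0 -> \sum_i ws i = 0 ->
  energy zs ws (z - alpha *: \sum_i y i) (fun i => w i - alpha *: (x i - xb))
  = energy zs ws z w
    - 2 * alpha * (\sum_i (dotv (z - x i) (y i - w i) + dotv (x i - zs) (y i - ws i)))
    + alpha ^+ 2 * (sqnorm (\sum_i y i) + \sum_i sqnorm (x i - xb)).
Proof.
move=> w0 ws0; rewrite /energy.
have E u v : sqnorm (u - alpha *: v) =
    sqnorm u - 2 * alpha * dotv u v + alpha ^+ 2 * sqnorm v :> R.
  by rewrite /sqnorm !dotvE (dotvC v u); ring.
rewrite addrAC E; under [X in _ + X = _]eq_bigr do rewrite addrAC E.
rewrite big_split sumrB/= -!mulr_sumr.
have -> : \sum_i (dotv (z - x i) (y i - w i) + dotv (x i - zs) (y i - ws i))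
  = dotv (z - zs) (\sum_i y i) + \sum_i dotv (w i - ws i) (x i - xb).
  have F i : dotv (z - x i) (y i - w i) + dotv (x i - zs) (y i - ws i)
    = dotv (z - zs) (y i) + dotv (w i - ws i) (x i - xb)
      + (dotv (xb - z) (w i) + dotv (zs - xb) (ws i)).
    by rewrite !dotvE (dotvC (w i)) (dotvC (ws i)) (dotvC (w i) xb)
      (dotvC (ws i) xb); ring.
  under eq_bigr do rewrite F.
  by rewrite !big_split/= -!dotv_sumr w0 ws0 !dotv0r !addr0.
ring.
Qed.

(** * The pathwise inequality for one iteration *)

(** These constants are the outcome of [backward_bound], [forward_x_bound] and [direction_bound].
    For instance 10 + 8 L^2 is 2 + 4 (2 L^2 + 2), from splitting x - zs and then B z - w + eps. The
    argument s stands for sum_i |ws_i|^2. *)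
Definition backward_const (R : realType) n (tau : R) : R := 2 * n%:R + 2 * tau ^+ 2.
Definition forward_const (R : realType) (L : R) : R := 10 + 8 * L ^+ 2.
Definition direction_const (R : realType) n (tau L s : R) : R :=
  backward_const n tau + forward_const L + 2 * n.+1%:R
  * (tau ^- 2 * backward_const n tau + 2 * L ^+ 2 * forward_const L + 2 + s).

(** This is O_k, with the same filtered sums over ['I_n.+1] as in the theorem, so that the two are
    convertible. *)
Definition residual (R : realType) d n (B : 'rV[R]_d -> 'rV[R]_d) z
    (w x y : 'I_n.+1 -> 'rV[R]_d) : R :=
  \sum_(i < n.+1 | (i < n)%N) sqnorm (y i - w i)
  + \sum_(i < n.+1 | (i < n)%N) sqnorm (z - x i) + sqnorm (B z - w ord_max).

Lemma residual_ge0 (R : realType) d n (B : 'rV[R]_d -> 'rV[R]_d) z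
    (w x y : 'I_n.+1 -> 'rV[R]_d) : 0 <= residual B z w x y.
Proof.
by rewrite !addr_ge0 ?sqnorm_ge0//; apply: sumr_ge0 => i _; rewrite sqnorm_ge0.
Qed.

Section one_iteration.
Context (R : realType) (n d : nat).
Variables (A : 'I_n -> 'rV[R]_d -> set 'rV[R]_d) (B : 'rV[R]_d -> 'rV[R]_d).
Variables (L tau : R) (zs : 'rV[R]_d) (ws : 'I_n.+1 -> 'rV[R]_d).
Hypothesis mA : forall i, monotone_op (A i).
Hypothesis L0 : 0 < L.
Hypothesis mB : monotone_fun B.
Hypothesis BL : lipschitz_fun B L.
Hypothesis t0 : 0 < tau.
Hypothesis Aws : forall (i : 'I_n.+1) (hi : (i < n)%N), A (Ordinal hi) zs (ws i).
Hypothesis Bws : ws ord_max = B zs.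
Hypothesis ws0 : \sum_i ws i = 0.

Variables (rho : R) (z eps e : 'rV[R]_d) (w x y : 'I_n.+1 -> 'rV[R]_d).
Hypothesis rho0 : 0 < rho.
Hypothesis rho1 : rho <= 1.
Hypothesis rhoL : rho * L <= 2^-1.
Hypothesis xA : forall (i : 'I_n.+1) (hi : (i < n)%N),
  A (Ordinal hi) (x i) (y i) /\ z + tau *: w i = x i + tau *: y i.
Hypothesis xB : x ord_max = z - rho *: (B z + eps - w ord_max).
Hypothesis yB : y ord_max = B (x ord_max) + e.

(** The constant c lies below the three coefficients available: 1 / (2 tau) and tau / 2 from the
    backward steps, and 1 - rho L >= 1/2 from the forward step. *)
Lemma gap_lower_bound c : c <= (2 * tau)^-1 -> c <= tau / 2 -> c <= 2^-1 -> 0 <= c ->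
  c * rho * residual B z w x y + rho * (1 - 2 * (rho * L)) * dotv eps (B z - w ord_max)
    + dotv e (z - zs) - rho ^+ 2 * L * sqnorm eps
  <= \sum_i (dotv (z - x i) (y i - w i) + dotv (x i - zs) (y i - ws i)).
Proof.
move=> c1 c2 c3 c0; rewrite sum_ord_max.
have H1 : c * rho * (\sum_(i < n.+1 | (i < n)%N) sqnorm (y i - w i)
     + \sum_(i < n.+1 | (i < n)%N) sqnorm (z - x i)) <=
  \sum_(i < n.+1 | (i < n)%N) (dotv (z - x i) (y i - w i) + dotv (x i - zs) (y i - ws i)).
  rewrite -big_split mulr_sumr/=; apply: ler_sum => i hi.
  have [Ai Ei] := xA hi.
  have := mA Ai (Aws hi); rewrite (backward_step_gap t0 Ei).
  have := sqnorm_ge0 (y i - w i); have := sqnorm_ge0 (z - x i).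
  move: (sqnorm (y i - w i)) (sqnorm (z - x i)) (dotv _ _) => p q r q0 p0 r0.
  have := ler_wpM2r q0 c1; have := ler_wpM2r p0 c2.
  (* The backward indices gain a full c; a factor rho <= 1 is given away to match the forward
     index. *)
  have : c * rho * (p + q) <= c * (p + q).
    by rewrite ler_wpM2r ?addr_ge0// ler_piMr.
  by rewrite mulrDr; lra.
have := forward_step_gap L0 BL rho0 xB.
have := mB (x ord_max) zs.
(* The noise e meets z - x in the first product and x - zs in the second. Their sum is z - zs, so x,
   which depends on eps, drops out. *)
have -> : dotv (z - x ord_max) (y ord_max - w ord_max)
    + dotv (x ord_max - zs) (y ord_max - ws ord_max)
  = dotv (z - x ord_max) (B (x ord_max) - w ord_max)
    + dotv (x ord_max - zs) (B (x ord_max) - B zs) + dotv e (z - zs).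
  rewrite yB Bws !dotvE (dotvC e zs) (dotvC e z).
  by ring.
have : c * rho * sqnorm (B z - w ord_max)
    <= rho * ((1 - rho * L) * sqnorm (B z - w ord_max)).
  have h : c <= 1 - rho * L by have := rhoL; lra.
  have := ler_wpM2r (sqnorm_ge0 (B z - w ord_max)) h.
  by rewrite -(ler_pM2l rho0) mulrA (mulrC rho c).
by move: H1; rewrite /residual; lra.
Qed.

Lemma residual_B_bound :
  sqnorm (B z - w ord_max) <= (2 * L ^+ 2 + 2) * energy zs ws z w.
Proof.
have -> : B z - w ord_max = (B z - B zs) - (w ord_max - ws ord_max).
  by rewrite Bws opprB addrA subrK.
apply: le_trans (sqnormB_le _ _) _.
have h1 := sqnorm_le_energy zs ws z w ord_max.
have h2 := lipschitz_sqnorm L0 BL z zs.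
have h3 := sqnorm_ge0 (z - zs); have h4 := sqnorm_ge0 (w ord_max - ws ord_max).
have L2 : 0 <= L ^+ 2 by rewrite sqr_ge0.
have : L ^+ 2 * sqnorm (z - zs) <= L ^+ 2 * energy zs ws z w.
  by rewrite ler_wpM2l//; lra.
lra.
Qed.

Lemma B_bound : sqnorm (B z) <= 2 * L ^+ 2 * energy zs ws z w + 2 * sqnorm (B zs).
Proof.
rewrite -[B z](subrK (B zs)); apply: le_trans (sqnormD_le _ _) _.
rewrite lerD2r -mulrA ler_pM2l//; apply: le_trans (lipschitz_sqnorm L0 BL z zs) _.
rewrite ler_wpM2l ?sqr_ge0//.
by have := sqnorm_le_energy zs ws z w ord_max; have := sqnorm_ge0 (w ord_max - ws ord_max); lra.
Qed.

Lemma forward_x_bound : sqnorm (x ord_max - zs)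
  <= forward_const L * (energy zs ws z w + sqnorm eps).
Proof.
have -> : x ord_max - zs = (z - zs) - rho *: ((B z - w ord_max) + eps).
  by rewrite xB addrAC; congr (_ - _ *: _); rewrite addrAC.
apply: le_trans (sqnormB_le _ _) _; rewrite sqnormZ.
have r2 : rho ^+ 2 <= 1 by rewrite expr_le1// ltW.
have h1 := sqnorm_le_energy zs ws z w ord_max.
have h4 := sqnorm_ge0 (w ord_max - ws ord_max).
have h2 := residual_B_bound.
have h3 := sqnormD_le (B z - w ord_max) eps.
have h5 : rho ^+ 2 * sqnorm (B z - w ord_max + eps) <= sqnorm (B z - w ord_max + eps).
  by rewrite ler_piMl ?sqnorm_ge0.
have h6 : 0 <= L ^+ 2 * sqnorm eps by rewrite mulr_ge0 ?sqr_ge0 ?sqnorm_ge0.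
have h7 := sqnorm_ge0 eps.
rewrite /forward_const; lra.
Qed.

Lemma forward_B_bound : sqnorm (B (x ord_max))
  <= 2 * L ^+ 2 * forward_const L * (energy zs ws z w + sqnorm eps) + 2 * sqnorm (B zs).
Proof.
rewrite -[B (x _)](subrK (B zs)); apply: le_trans (sqnormD_le _ _) _.
have := ler_wpM2l (sqr_ge0 L) forward_x_bound.
by have := lipschitz_sqnorm L0 BL (x ord_max) zs; lra.
Qed.

Lemma backward_bound :
  \sum_(i < n.+1 | (i < n)%N) sqnorm (x i - zs)
  + tau ^+ 2 * \sum_(i < n.+1 | (i < n)%N) sqnorm (y i - ws i)
  <= backward_const n tau * energy zs ws z w.
Proof.
apply: (@le_trans _ _ (\sum_(i < n.+1 | (i < n)%N)
   (2 * sqnorm (z - zs) + 2 * (tau ^+ 2 * sqnorm (w i - ws i))))).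
  rewrite mulr_sumr -big_split/=; apply: ler_sum => i hi.
  have [Ai Ei] := xA hi; exact: backward_step_bound t0 (@mA _) Ai (Aws hi) Ei.
rewrite big_split/= -!mulr_sumr.
have -> : \sum_(i < n.+1 | (i < n)%N) sqnorm (z - zs) = n%:R * sqnorm (z - zs).
  apply: (addIr (sqnorm (z - zs))).
  rewrite -(sum_ord_max (fun=> sqnorm (z - zs))) sumr_const card_ord.
  by rewrite -[_ *+ _]mulr_natl -natr1 mulrDl mul1r.
have h0 : 0 <= \sum_(i < n.+1 | (i < n)%N) sqnorm (w i - ws i).
  by apply: sumr_ge0 => i _; exact: sqnorm_ge0.
have : \sum_(i < n.+1 | (i < n)%N) sqnorm (w i - ws i) <= energy zs ws z w - sqnorm (z - zs).
  by rewrite /energy addrAC subrr add0r sum_ord_max lerDl sqnorm_ge0.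
have h3 := sqnorm_ge0 (z - zs).
move: h0; set q := \sum_(i < _ | _) _ => h0 h1.
have h2 : 0 <= n%:R * q by rewrite mulr_ge0.
have := ler_wpM2l (sqr_ge0 tau) h1; have := ler_wpM2l (ler0n R n) h1.
have : 0 <= tau ^+ 2 * sqnorm (z - zs) by rewrite mulr_ge0 ?sqr_ge0.
rewrite /backward_const; lra.
Qed.

(** The y_i are compared with ws_i, and the x_i with zs, which may replace their mean by
    [sqnorm_center_le]. The summand 1 on the right absorbs the fixed quantity sum_i |ws_i|^2. *)
Lemma direction_bound :
  sqnorm (\sum_i y i) + \sum_i sqnorm (x i - n.+1%:R^-1 *: \sum_j x j)
    <= direction_const n tau L (\sum_i sqnorm (ws i))
       * (1 + energy zs ws z w + sqnorm eps + sqnorm e).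
Proof.
have V0 := energy_ge0 zs ws z w; have e0 := sqnorm_ge0 e; have p0 := sqnorm_ge0 eps.
set W := 1 + _ + _ + _; have W1 : 1 <= W by rewrite /W; lra.
have W0 : 0 <= W by lra.
set cA := backward_const n tau.
set cB := forward_const L.
have cA0 : 0 <= cA by rewrite /cA /backward_const; have := sqr_ge0 tau; have := ler0n R n; lra.
have cB0 : 0 <= cB by rewrite /cB /forward_const; have := sqr_ge0 L; lra.
have S0 : 0 <= \sum_i sqnorm (ws i) by apply: sumr_ge0 => i _; exact: sqnorm_ge0.
set P := \sum_(i < n.+1 | (i < n)%N) sqnorm (x i - zs).
set Q := \sum_(i < n.+1 | (i < n)%N) sqnorm (y i - ws i).
have P0 : 0 <= P by apply: sumr_ge0 => i _; exact: sqnorm_ge0.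
have Q0 : 0 <= Q by apply: sumr_ge0 => i _; exact: sqnorm_ge0.
have hPQ : P + tau ^+ 2 * Q <= cA * W.
  apply: le_trans backward_bound _; rewrite ler_wpM2l// /W; lra.
have hP : P <= cA * W.
  by apply: le_trans hPQ; rewrite lerDl mulr_ge0 ?sqr_ge0.
have hQ : Q <= tau ^- 2 * cA * W.
  rewrite -mulrA ler_pdivlMl ?exprn_gt0//; apply: le_trans hPQ.
  by rewrite lerDr.
(* Here W - 1 - |e|^2 is V + |eps|^2. *)
have hx : sqnorm (x ord_max - zs) <= cB * (W - 1 - sqnorm e).
  apply: le_trans forward_x_bound _; rewrite ler_wpM2l// /W; lra.
have hxW : sqnorm (x ord_max - zs) <= cB * W.
  apply: le_trans hx _; rewrite ler_wpM2l//; lra.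
have hy : sqnorm (y ord_max - ws ord_max) <= (2 * L ^+ 2 * cB + 2) * W.
  have -> : y ord_max - ws ord_max = (B (x ord_max) - B zs) + e.
    by rewrite yB Bws addrAC.
  apply: le_trans (sqnormD_le _ _) _.
  have := lipschitz_sqnorm L0 BL (x ord_max) zs.
  have := ler_wpM2l (sqr_ge0 L) hxW.
  have : sqnorm e <= W by rewrite /W; lra.
  lra.
have hX : \sum_i sqnorm (x i - n.+1%:R^-1 *: \sum_j x j) <= (cA + cB) * W.
  apply: le_trans (sqnorm_center_le x zs) _.
  by rewrite sum_ord_max -/P; lra.
have hY : \sum_i sqnorm (y i) <= 2 * (Q + sqnorm (y ord_max - ws ord_max))
                              + 2 * \sum_i sqnorm (ws i).
  rewrite -(sum_ord_max (fun i => sqnorm (y i - ws i))) !mulr_sumr -big_split/=.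
  by apply: ler_sum => i _; rewrite -{1}[y i](subrK (ws i)) sqnormD_le.
have SW : \sum_i sqnorm (ws i) <= (\sum_i sqnorm (ws i)) * W by rewrite ler_peMr.
have hYW : \sum_i sqnorm (y i) <= 2 *
    (tau ^- 2 * cA + 2 * L ^+ 2 * cB + 2 + \sum_i sqnorm (ws i)) * W by lra.
have := ler_wpM2l (ler0n R n.+1) hYW.
by have := sqnorm_sum_le y; rewrite /direction_const -/cA -/cB; lra.
Qed.

(** The exact energy change, with the gap bounded below and the direction bounded above. The two
    terms linear in the noise are still present with explicit coefficients. *)
Lemma one_iteration c alpha : c <= (2 * tau)^-1 -> c <= tau / 2 -> c <= 2^-1 ->
    0 <= c -> 0 <= alpha -> \sum_i w i = 0 ->
  energy zs ws (z - alpha *: \sum_i y i)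
    (fun i => w i - alpha *: (x i - n.+1%:R^-1 *: \sum_j x j))
    + 2 * alpha * c * rho * residual B z w x y
  <= energy zs ws z w
     - 2 * alpha * rho * (1 - 2 * (rho * L)) * dotv eps (B z - w ord_max)
     - 2 * alpha * dotv e (z - zs)
     + 2 * alpha * rho ^+ 2 * L * sqnorm eps
     + alpha ^+ 2 * (direction_const n tau L (\sum_i sqnorm (ws i))
       * (1 + energy zs ws z w + sqnorm eps + sqnorm e)).
Proof.
move=> c1 c2 c3 c0 a0 w0; rewrite energy_step//.
have := ler_wpM2l (sqr_ge0 alpha) direction_bound.
have := ler_wpM2l (mulr_ge0 (ler0n R 2) a0) (gap_lower_bound c1 c2 c3 c0).
lra.
Qed.
End one_iteration.

(** * Measurability of Lipschitz images *)

(* A set [h < c] is the union of the countably many rational cubes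
   [|X l - q l| < r] that it contains; no topology on ['rV_d] is needed. *)
Lemma measurable_lipschitz_comp (R : realType) (dm : measure_display)
    (T : measurableType dm) d (X : T -> 'rV[R]_d) (h : T -> R) (C : R) :
  (forall l, measurable_fun setT (fun t => X t ord0 l)) ->
  (forall t t', (h t - h t') ^+ 2 <= C * sqnorm (X t - X t')) ->
  measurable_fun setT h.
Proof.
move=> mX hX; apply: (measurability _ (RGenInftyO.measurableE R)) => //.
move=> _ [_ [c ->] <-]; rewrite setTI.
pose cube (p : {ffun 'I_d -> rat} * rat) : set T :=
  [set t | forall l, `|X t ord0 l - ratr (p.1 l)| < ratr p.2].
have mcube p : measurable (cube p).
  have -> : cube p = \bigcap_(l in [set: 'I_d])
      (fun t => X t ord0 l) @^-1` [set r | `|r - ratr (p.1 l)| < ratr p.2].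
    by apply/seteqP; split => t /= H l; [move=> _|]; exact: H.
  apply: fin_bigcap_measurable => // l _.
  rewrite -[X in measurable X]setTI; apply: mX => //.
  rewrite (_ : [set r | _] = [set` `]ratr (p.1 l) - ratr p.2, ratr (p.1 l) + ratr p.2[]).
    exact: measurable_itv.
  by apply/seteqP; split => r /=; rewrite in_itv/= ltr_distl.
rewrite (_ : _ @^-1` _ = \bigcup_p (if `[< cube p `<=` [set t | h t < c] >]
                                    then cube p else set0)).
  apply: countable_bigcupT_measurable => // p; by case: ifP.
apply/seteqP; split => [t /=|t [p _]]; last first.
  by case: ifPn => // /asboolP cp /cp; rewrite /= in_itv.
rewrite in_itv/= => htc.
pose e := c - h t; have e0 : 0 < e by rewrite subr_gt0.
(* A radius r < 1 with r D < e^2 is small enough: two points of the cube differ by less than 2 r in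
   each coordinate, so (h t' - h t)^2 <= |C| 4 d r^2 <= D r < e^2, where e is the margin c - h t.
   The summand 1 keeps D positive. *)
pose D := `|C| * (4 * d%:R) + 1.
have D1 : 1 <= D by rewrite lerDr mulr_ge0.
have D0 : 0 < D by lra.
have [r] : exists r, ratr r \in `]0, (Num.min 1 (e ^+ 2 / D))[.
  by apply: rat_in_itvoo; rewrite lt_min ltr01 divr_gt0 ?exprn_gt0.
rewrite in_itv/= lt_min => /and3P[r0 r1 rD].
have /choice[q qP] (l : 'I_d) : exists q, ratr q \in `]X t ord0 l - ratr r, X t ord0 l[.
  by apply: rat_in_itvoo; rewrite gtrBl.
have qr l : `|X t ord0 l - ratr (q l)| < ratr r.
  by have := qP l; rewrite in_itv/= => /andP[q1 q2]; rewrite gtr0_norm; lra.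
exists (finfun q, r) => //; rewrite ifT; first by move=> l /=; rewrite ffunE.
apply/asboolP => t' /= t'c; rewrite -subr_gt0.
suff : (h t' - h t) ^+ 2 < e ^+ 2.
  have -> : c - h t' = e - (h t' - h t) by rewrite /e; ring.
  by move: (h t' - h t) (e) e0 => u e' e0; nra.
apply: le_lt_trans (hX t' t) _.
have : sqnorm (X t' - X t) <= 4 * d%:R * (ratr r) ^+ 2.
  rewrite /sqnorm /dotv; apply: (@le_trans _ _ (\sum_(l < d) (2 * ratr r) ^+ 2)).
    apply: ler_sum => l _; rewrite -expr2 !mxE.
    have := qr l; have := t'c l; rewrite ffunE.
    move=> /ltr_normlP[a1 a2] /ltr_normlP[a3 a4].
    rewrite -real_normK ?num_real// lerXn2r ?nnegrE//; first by lra.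
    by rewrite ler_norml; apply/andP; split; lra.
  by rewrite sumr_const card_ord -mulr_natl le_eqVlt; apply/orP; left; apply/eqP; ring.
move=> hs; apply: (@le_lt_trans _ _ (`|C| * (4 * d%:R * ratr r ^+ 2))).
  apply: (@le_trans _ _ (`|C| * sqnorm (X t' - X t))).
    by rewrite ler_wpM2r ?sqnorm_ge0 ?ler_norm.
  by rewrite ler_wpM2l.
move: rD; rewrite ltr_pdivlMr// => rD.
apply: le_lt_trans rD; apply: (@le_trans _ _ (D * ratr r ^+ 2)).
  by rewrite /D; have := sqr_ge0 (ratr r : R); lra.
rewrite mulrC ler_pM2r// expr2 ler_piMr ?ltW//.
Qed.

(** * Generated sigma-algebras and pulling known factors out of a centered variable *)

Lemma gen_sigma_measurable (R : realType) (dm : measure_display)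
    (T : measurableType dm) (fs : set (T -> R)) :
  (forall f, fs f -> measurable_fun setT f) -> gen_sigma fs `<=` measurable.
Proof.
move=> mfs; apply: smallest_sub; first exact: sigma_algebra_measurable.
by move=> _ [f [U [ff [mU ->]]]]; rewrite -[X in measurable X]setTI; exact: mfs.
Qed.

Lemma measurable_gen_sigma (R : realType) (dm : measure_display)
    (T : measurableType dm) (fs : set (T -> R)) f : fs f ->
  measurable_fun setT (f : g_sigma_algebraType (preimage_sets fs) -> R).
Proof.
move=> ff _ U mU; rewrite setTI; apply: sub_sigma_algebra.
by exists f, U.
Qed.

Import HBSimple HBNNSimple.

Section pull_out.
Context (R : realType) (dm : measure_display) (T : measurableType dm).
Variables (P : probability T R) (G : set (set T)) (X : T -> R).
Hypothesis GT : <<s G >> `<=` measurable.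
Hypothesis iX : P.-integrable setT (EFin \o X).
Hypothesis X0 : forall S, <<s G >> S -> (\int[P]_(t in S) (X t)%:E = 0)%E.

(** A simple function is a finite combination of indicators of sets of the sub-sigma-algebra, and X
    has zero integral over each of them. *)
Lemma integral_mul_nnsfun0 (g : {nnsfun (g_sigma_algebraType G) >-> R}) :
  (\int[P]_t (X t * g t)%:E = 0)%E.
Proof.
have mg r : <<s G >> (g @^-1` [set r]).
  exact: (measurable_funPTI g (measurable_set1 r)).
have iXr r : P.-integrable setT ((EFin \o X) \_ (g @^-1` [set r])).
  apply/integrable_restrict => //; first exact: GT.
  by apply: integrableS iX => //; apply: measurableI => //; exact: GT.
have [s gE] : exists s : seq R, forall t,
    g t = \sum_(r <- s) r * \1_(g @^-1` [set r]) t.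
  exists (finmap.enum_fset (fset_set (range g))) => t.
  by rewrite [LHS]fimfunE fsbig_finite.
transitivity (\int[P]_t \sum_(r <- s)
    (r%:E * ((EFin \o X) \_ (g @^-1` [set r])) t))%E.
  apply: eq_integral => t _; rewrite gE mulr_sumr -sumEFin.
  apply: eq_bigr => r _; rewrite /patch indicE; case: ifP => _ /=.
    by rewrite -EFinM mulr1 mulrC.
  by rewrite !mulr0 mule0.
rewrite integral_sum//; last by move=> r; exact: integrableZl.
apply: big1 => r _; rewrite integralZl// -integral_mkcond X0 ?mule0//; exact: mg.
Qed.

(** The simple approximations of Y are taken in the sub-sigma-algebra, so the previous lemma applies
    to each. They lie between 0 and Y, hence |X Y| dominates and the limit is again 0. *)
Lemma integral_mul_ge0_0 (Y : T -> R) : (forall t, 0 <= Y t) ->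
  measurable_fun setT (Y : g_sigma_algebraType G -> R) ->
  P.-integrable setT (fun t => (X t * Y t)%:E) ->
  (\int[P]_t (X t * Y t)%:E = 0)%E.
Proof.
move=> Y0 mY iXY.
have /measurable_EFinP mEY := mY.
pose g := nnsfun_approx (@measurableT _ (g_sigma_algebraType G)) mEY.
have Y0' t : [set: T] t -> (0 <= (EFin \o Y) t)%E by rewrite lee_fin.
have gY n t : g n t <= Y t.
  by rewrite /g nnsfun_approxE -lee_fin; exact: (@le_approx _ (g_sigma_algebraType G)).
have mgn n : measurable_fun setT (g n : T -> R).
  by move=> _ U mU; rewrite setTI; apply: GT; exact: (measurable_funPTI (g n) mU).
have mX : measurable_fun setT X.
  by apply/measurable_EFinP; exact: measurable_int iX.
have cXg t : (X t * g n t)%:E @[n --> \oo] --> (X t * Y t)%:E.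
  under eq_fun do rewrite EFinM.
  by rewrite EFinM; apply: cvgeZl => //;
     exact: (@cvg_nnsfun_approx _ (g_sigma_algebraType G) R setT measurableT _ mEY Y0' t I).
have g0 n t : 0 <= g n t by exact: fun_ge0.
have XgXY t n : (`|(X t * g n t)%:E| <= `|(X t * Y t)%:E|)%E.
  rewrite lee_fin !normrM ler_wpM2l// !ger0_norm ?gY// ?g0 ?Y0.
have [_ _] := @dominated_convergence _ _ _ P setT measurableT
  (fun n t => (X t * g n t)%:E) (fun t => (X t * Y t)%:E) (fun t => `|(X t * Y t)%:E|%E)
  (fun n => proj2 (measurable_EFinP _ _) (measurable_funM mX (mgn n)))
  (measurable_int _ iXY) (aeW _ (fun t _ => cXg t)) (integrable_abse iXY)
  (aeW _ (fun t n _ => XgXY t n)).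
under eq_fun do rewrite integral_mul_nnsfun0.
by move=> /cvg_lim <-//; rewrite lim_cst.
Qed.

Lemma integral_mul0 (Y : T -> R) :
  measurable_fun setT (Y : g_sigma_algebraType G -> R) ->
  P.-integrable setT (fun t => (X t * Y t)%:E) ->
  (\int[P]_t (X t * Y t)%:E = 0)%E.
Proof.
move=> mY iXY.
have mX : measurable_fun setT X.
  by apply/measurable_EFinP; exact: measurable_int iX.
have part (Z : T -> R) : (forall t, 0 <= Z t) ->
    measurable_fun setT (Z : g_sigma_algebraType G -> R) ->
    (forall t, Z t <= `|Y t|) -> P.-integrable setT (fun t => (X t * Z t)%:E).
  move=> Z0 mZ ZY; apply: le_integrable iXY => //.
    apply/measurable_EFinP; apply: measurable_funM => //.
    by move=> _ U mU; rewrite setTI; apply: GT; rewrite -[X in <<s G >> X]setTI; exact: mZ.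
  by move=> t _; rewrite lee_fin !normrM ler_wpM2l// ger0_norm.
have mp : measurable_fun setT (Y^\+ : g_sigma_algebraType G -> R).
  exact: measurable_funrpos.
have mn : measurable_fun setT (Y^\- : g_sigma_algebraType G -> R).
  exact: measurable_funrneg.
have ip : P.-integrable setT (fun t => (X t * Y^\+ t)%:E).
  by apply: part => // t; rewrite -/((Num.norm \o Y) t) -funrposDneg lerDl.
have im : P.-integrable setT (fun t => (X t * Y^\- t)%:E).
  by apply: part => // t; rewrite -/((Num.norm \o Y) t) -funrposDneg lerDr.
have -> : (fun t => (X t * Y t)%:E)
  = (fun t => (X t * Y^\+ t)%:E - (X t * Y^\- t)%:E)%E.
  by apply/funext => t; rewrite -EFinB -mulrBr -[Y in LHS]funrposBneg.
by rewrite integralB// !integral_mul_ge0_0// sube0.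
Qed.
End pull_out.

Lemma integrable_dominated (R : realType) (dm : measure_display) (T : measurableType dm)
    (P : probability T R) (f g : T -> R) :
  measurable_fun setT f -> (forall t, `|f t| <= g t) ->
  P.-integrable setT (EFin \o g) -> P.-integrable setT (EFin \o f).
Proof.
move=> mf fg; apply: le_integrable => //; first exact/measurable_EFinP.
by move=> t _; rewrite lee_fin (le_trans (fg t))// ler_norm.
Qed.

Lemma measurable_sqnorm (R : realType) (dm : measure_display) (T : measurableType dm) d
    (X : T -> 'rV[R]_d) : (forall l, measurable_fun setT (fun t => X t ord0 l)) ->
  measurable_fun setT (fun t => sqnorm (X t)).
Proof.
by move=> mX; apply: measurable_sum => l; exact: measurable_funM.
Qed.

(** The pull-out property is used coordinate by coordinate; each product is integrable because |a b|
    <= a^2 + b^2 and both squared norms are integrable. *)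
Lemma cond_exp_zero_dotv (R : realType) (dm : measure_display) (T : measurableType dm)
    (P : probability T R) d (fs : set (T -> R)) (X Y : T -> 'rV[R]_d) :
  (forall f, fs f -> measurable_fun setT f) ->
  (forall l, cond_exp_zero P (gen_sigma fs) (fun t => X t ord0 l)) ->
  (forall l, measurable_fun setT
     ((fun t => Y t ord0 l) : g_sigma_algebraType (preimage_sets fs) -> R)) ->
  P.-integrable setT (EFin \o (fun t => sqnorm (X t))) ->
  P.-integrable setT (EFin \o (fun t => sqnorm (Y t))) ->
  P.-integrable setT (EFin \o (fun t => dotv (X t) (Y t))) /\
  (\int[P]_t (dotv (X t) (Y t))%:E = 0)%E.
Proof.
move=> mfs X0 mY iX iY; have GT := gen_sigma_measurable mfs.
have mX l : measurable_fun setT (fun t => X t ord0 l).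
  by apply/measurable_EFinP; exact: measurable_int (X0 l).1.
have mY' l : measurable_fun setT (fun t => Y t ord0 l).
  move=> _ U mU; rewrite setTI; apply: GT.
  by rewrite -[X in gen_sigma fs X]setTI; exact: mY.
have iXY l : P.-integrable setT (fun t => (X t ord0 l * Y t ord0 l)%:E).
  apply: (@integrable_dominated _ _ _ _ _ (fun t => sqnorm (X t) + sqnorm (Y t))).
  - exact: measurable_funM.
  - move=> t; have sq (Z : 'rV[R]_d) : (Z ord0 l) ^+ 2 <= sqnorm Z.
      by rewrite /sqnorm /dotv (bigD1 l)//= -expr2 lerDl sumr_ge0// => j _;
         rewrite -expr2 sqr_ge0.
    apply: le_trans (lerD (sq _) (sq _)).
    move: (X t _ _) (Y t _ _) => a b; rewrite ler_norml; apply/andP; split; nra.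
  - exact: (integrableD measurableT iX iY).
have E : (fun t => (dotv (X t) (Y t))%:E)
    = (fun t => \sum_(l < d) (X t ord0 l * Y t ord0 l)%:E)%E.
  by apply/funext => t; rewrite sumEFin.
split; first by rewrite [_ \o _]E; exact: integrable_sum.
rewrite E integral_sum// big1// => l _.
exact: (integral_mul0 GT (X0 l).1 (X0 l).2 (mY l) (iXY l)).
Qed.

(** * Random vectors, measurable coordinate by coordinate *)

Definition measurable_vec (R : realType) (dm : measure_display) (T : measurableType dm) d
    (X : T -> 'rV[R]_d) := forall l, measurable_fun setT (fun t => X t ord0 l).

Section measurable_vec_theory.
Context (R : realType) (dm : measure_display) (T : measurableType dm) (d : nat).
Implicit Types X Y : T -> 'rV[R]_d.

Lemma measurable_vec_cst (v : 'rV[R]_d) : measurable_vec (fun _ : T => v).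
Proof. by move=> l; exact: measurable_cst. Qed.

Lemma measurable_vecD X Y : measurable_vec X -> measurable_vec Y ->
  measurable_vec (fun t => X t + Y t).
Proof.
move=> mX mY l; under eq_fun do rewrite mxE.
exact: measurable_funD.
Qed.

Lemma measurable_vecZ (c : R) X : measurable_vec X -> measurable_vec (fun t => c *: X t).
Proof.
move=> mX l; under eq_fun do rewrite mxE.
exact: measurable_funM.
Qed.

Lemma measurable_vecB X Y : measurable_vec X -> measurable_vec Y ->
  measurable_vec (fun t => X t - Y t).
Proof.
move=> mX mY; under [fun _ => _]eq_fun do rewrite -scaleN1r.
by apply: measurable_vecD => //; exact: measurable_vecZ.
Qed.

Lemma measurable_vec_sum (I : finType) (X : I -> T -> 'rV[R]_d) :
  (forall i, measurable_vec (X i)) -> measurable_vec (fun t => \sum_i X i t).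
Proof.
move=> mX l; under eq_fun do rewrite summxE.
by apply: measurable_sum => i; exact: mX.
Qed.

Lemma measurable_vec_lipschitz X Y (C : R) : measurable_vec X ->
  (forall t t', sqnorm (Y t - Y t') <= C * sqnorm (X t - X t')) -> measurable_vec Y.
Proof.
move=> mX XY l; apply: (measurable_lipschitz_comp (C := C) mX) => t t'.
apply: le_trans (XY t t'); rewrite /sqnorm /dotv (bigD1 l)//= !mxE -expr2.
by rewrite lerDl sumr_ge0// => j _; rewrite -expr2 sqr_ge0.
Qed.

Lemma measurable_energy n (zs : 'rV[R]_d) (ws : 'I_n.+1 -> 'rV[R]_d) X
    (W : 'I_n.+1 -> T -> 'rV[R]_d) : measurable_vec X -> (forall i, measurable_vec (W i)) ->
  measurable_fun setT (fun t => energy zs ws (X t) (fun i => W i t)).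
Proof.
move=> mX mW; apply: measurable_funD.
  by apply: measurable_sqnorm; apply: measurable_vecB => //; exact: measurable_vec_cst.
apply: measurable_sum => i.
by apply: measurable_sqnorm; apply: measurable_vecB => //; exact: measurable_vec_cst.
Qed.
End measurable_vec_theory.

(** * Real-valued expectations under a probability *)

Section expectation.
Context (R : realType) (dm : measure_display) (T : measurableType dm).
Variable P : probability T R.
Implicit Types f g : T -> R.

Local Notation L1 f := (P.-integrable setT (EFin \o f)).
Local Notation E f := (\int[P]_t f t).

Lemma integrable_lin (a b : R) f g : L1 f -> L1 g ->
  L1 (fun t => a * f t + b * g t).
Proof.
move=> /(integrableZl measurableT a) if_ /(integrableZl measurableT b) ig.
exact: (integrableD measurableT if_ ig).
Qed.

Lemma Rintegral_lin (a b : R) f g : L1 f -> L1 g ->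
  E (fun t => a * f t + b * g t) = a * E f + b * E g.
Proof.
move=> if_ ig; rewrite RintegralD// ?RintegralZl//.
  exact: (integrableZl measurableT a if_).
exact: (integrableZl measurableT b ig).
Qed.

Lemma integrable_prob_cst (c : R) : L1 (fun=> c).
Proof. exact: finite_measure_integrable_cst. Qed.

Lemma Rintegral_prob_cst (c : R) : E (fun=> c) = c.
Proof.
rewrite Rintegral_cst// -[RHS]mulr1; congr (_ * _).
transitivity (fine (1%E : \bar R)) => //; congr fine.
have h : P setT = 1%E := probability_setT P.
exact: h.
Qed.

Lemma EFin_Rintegral f : L1 f -> (\int[P]_t (f t)%:E)%E = (E f)%:E.
Proof. by move=> if_; rewrite /Rintegral fineK// integrable_fin_num. Qed.

(** This turns a noise bound between extended-real integrals into integrability and a real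
    inequality: finiteness of the integral of g passes to f. *)
Lemma integrable_integral_le f g : measurable_fun setT f -> (forall t, 0 <= f t) -> L1 g ->
  (\int[P]_t (f t)%:E <= \int[P]_t (g t)%:E)%E -> L1 f /\ E f <= E g.
Proof.
move=> mf f0 ig fg; have if_ : L1 f.
  apply/integrableP; split; first exact/measurable_EFinP.
  under eq_integral do rewrite /= ger0_norm//.
  by apply: le_lt_trans fg _; rewrite EFin_Rintegral// ltry.
by split=> //; rewrite -lee_fin -!EFin_Rintegral.
Qed.

Lemma integrable_affine_bound (a b : R) f g : measurable_fun setT f -> (forall t, 0 <= f t) ->
  L1 g -> (forall t, f t <= a * g t + b) -> L1 f /\ E f <= a * E g + b.
Proof.
move=> mf f0 ig fg; have igb : L1 (fun t => a * g t + b * 1).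
  by apply: integrable_lin => //; exact: integrable_prob_cst.
have if_ : L1 f.
  by apply: integrable_dominated igb => // t; rewrite ger0_norm// mulr1.
split=> //; have -> : a * E g + b = E (fun t => a * g t + b * 1).
  rewrite (@Rintegral_lin _ _ _ (fun=> 1))//; last exact: integrable_prob_cst.
  by rewrite Rintegral_prob_cst mulr1.
by apply: le_Rintegral => // t _; rewrite mulr1.
Qed.

End expectation.

(** * The inequality for one iteration in expectation *)

(** The first two constants bound E|eps|^2 and E|e|^2 by multiples of 1 + E V, with s = |B zs|^2.
    [growth_const] is the resulting coefficient of rho^4 (1 + E V) once alpha = Cf rho^2 is
    substituted, with s' = sum_i |ws_i|^2. *)
Definition forward_noise_const (R : realType) (L N1 N2 s : R) : R :=
  N1 + N2 * (2 * L ^+ 2 + 2 * s).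
Definition sample_noise_const (R : realType) (L N1 N2 N3 N4 s : R) : R :=
  N3 + N4 * (2 * L ^+ 2 * forward_const L * (1 + forward_noise_const L N1 N2 s) + 2 * s).
Definition growth_const (R : realType) n (tau L Cf N1 N2 N3 N4 s s' : R) : R :=
  2 * Cf * L * forward_noise_const L N1 N2 s
  + Cf ^+ 2 * direction_const n tau L s'
    * (1 + forward_noise_const L N1 N2 s + sample_noise_const L N1 N2 N3 N4 s).

Section expected_iteration.
Context (R : realType) (n d : nat).
Variables (A : 'I_n -> 'rV[R]_d -> set 'rV[R]_d) (B : 'rV[R]_d -> 'rV[R]_d).
Variables (L tau Cf : R) (zs : 'rV[R]_d) (ws : 'I_n.+1 -> 'rV[R]_d).
Hypothesis mA : forall i, monotone_op (A i).
Hypothesis L0 : 0 < L.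
Hypothesis mB : monotone_fun B.
Hypothesis BL : lipschitz_fun B L.
Hypothesis t0 : 0 < tau.
Hypothesis Cf0 : 0 < Cf.
Hypothesis Aws : forall (i : 'I_n.+1) (hi : (i < n)%N), A (Ordinal hi) zs (ws i).
Hypothesis Bws : ws ord_max = B zs.
Hypothesis ws0 : \sum_i ws i = 0.
Variables (N1 N2 N3 N4 : R).
Hypotheses (N1_ge0 : 0 <= N1) (N2_ge0 : 0 <= N2) (N3_ge0 : 0 <= N3) (N4_ge0 : 0 <= N4).

Variables (rho : R).
Hypothesis rho0 : 0 < rho.
Hypothesis rho1 : rho <= 1.
Hypothesis rhoL : rho * L <= 2^-1.
Let alpha := Cf * rho ^+ 2.

Context (dm : measure_display) (T : measurableType dm) (P : probability T R).
Variables (z z' eps e : T -> 'rV[R]_d) (w w' x y : 'I_n.+1 -> T -> 'rV[R]_d).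
Hypothesis xA : forall t (i : 'I_n.+1) (hi : (i < n)%N),
  A (Ordinal hi) (x i t) (y i t) /\ z t + tau *: w i t = x i t + tau *: y i t.
Hypothesis xB : forall t, x ord_max t = z t - rho *: (B (z t) + eps t - w ord_max t).
Hypothesis yB : forall t, y ord_max t = B (x ord_max t) + e t.
Hypothesis zE : forall t, z' t = z t - alpha *: \sum_i y i t.
Hypothesis wE : forall t i,
  w' i t = w i t - alpha *: (x i t - n.+1%:R^-1 *: \sum_j x j t).

(** The increments of the w_i are multiples of deviations from a mean, which sum to zero. *)
Lemma sum_w_step t : \sum_i w i t = 0 -> \sum_i w' i t = 0.
Proof.
move=> w0; under eq_bigr do rewrite wE.
rewrite sumrB w0 sub0r -scaler_sumr sumrB sumr_const card_ord -scaler_nat scalerA.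
by rewrite divff ?pnatr_eq0// scale1r subrr scaler0 oppr0.
Qed.

Section measurability.
Hypotheses (mz : measurable_vec z) (mw : forall i, measurable_vec (w i)).
Hypotheses (me : measurable_vec e) (mp : measurable_vec eps).

Lemma measurable_B (X : T -> 'rV[R]_d) : measurable_vec X ->
  measurable_vec (fun t => B (X t)).
Proof.
move=> mX; apply: (measurable_vec_lipschitz (C := L ^+ 2) mX) => t t'.
exact: lipschitz_sqnorm.
Qed.

(* The points x_i are known along the iteration only; as functions of z + tau w_i they are
   nonexpansive there, so it is not needed that the resolvent is defined everywhere. *)
Lemma measurable_x i : measurable_vec (x i).
Proof.
have [hi|] := ltnP i n.
  apply: (measurable_vec_lipschitz (C := 1) (X := fun t => z t + tau *: w i t)).
    by apply: measurable_vecD => //; exact: measurable_vecZ.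
  move=> t t'; have [Ax Ex] := xA t hi; have [Ax' Ex'] := xA t' hi.
  rewrite mul1r Ex Ex'; apply: le_trans (resolvent_nonexpansive t0 (@mA _) Ax Ax').
  by rewrite lerDl mulr_ge0 ?sqr_ge0 ?sqnorm_ge0.
move=> ni; have -> : i = ord_max.
  by apply/val_inj/eqP; rewrite eqn_leq ni -ltnS ltn_ord.
rewrite (_ : x ord_max = fun t => z t - rho *: (B (z t) + eps t - w ord_max t)); last first.
  exact/funext.
apply: measurable_vecB => //; apply: measurable_vecZ; apply: measurable_vecB => //.
by apply: measurable_vecD => //; exact: measurable_B.
Qed.

Lemma measurable_y i : measurable_vec (y i).
Proof.
have [hi|] := ltnP i n.
  rewrite (_ : y i = fun t => tau^-1 *: (z t + tau *: w i t - x i t)).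
    apply: measurable_vecZ; apply: measurable_vecB; last exact: measurable_x.
    by apply: measurable_vecD => //; exact: measurable_vecZ.
  apply/funext => t; have [_ ->] := xA t hi.
  by rewrite addrAC subrr add0r scalerA mulVf ?scale1r// gt_eqF.
move=> ni; have -> : i = ord_max.
  by apply/val_inj/eqP; rewrite eqn_leq ni -ltnS ltn_ord.
rewrite (_ : y ord_max = fun t => B (x ord_max t) + e t); last exact/funext.
by apply: measurable_vecD => //; apply: measurable_B; exact: measurable_x.
Qed.

Lemma measurable_step : measurable_vec z' /\ forall i, measurable_vec (w' i).
Proof.
split=> [|i].
  rewrite (_ : z' = fun t => z t - alpha *: \sum_i y i t); last exact/funext.
  apply: measurable_vecB => //; apply: measurable_vecZ; apply: measurable_vec_sum => i.
  exact: measurable_y.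
rewrite (_ : w' i = fun t => w i t - alpha *: (x i t - n.+1%:R^-1 *: \sum_j x j t)).
  apply: measurable_vecB => //; apply: measurable_vecZ; apply: measurable_vecB.
    exact: measurable_x.
  by apply: measurable_vecZ; apply: measurable_vec_sum => j; exact: measurable_x.
exact/funext.
Qed.

Lemma measurable_residual :
  measurable_fun setT (fun t => residual B (z t) (w^~ t) (x^~ t) (y^~ t)).
Proof.
have sum (X : 'I_n.+1 -> T -> 'rV[R]_d) : (forall i, measurable_vec (X i)) ->
    measurable_fun setT (fun t => \sum_(i < n.+1 | (i < n)%N) sqnorm (X i t)).
  move=> mX; under eq_fun do rewrite -big_filter.
  by apply: measurable_sum => i; apply: measurable_sqnorm; exact: mX.
apply: measurable_funD; first apply: measurable_funD.
- by apply: (sum (fun i t => y i t - w i t)) => i; apply: measurable_vecB => //;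
    exact: measurable_y.
- by apply: (sum (fun i t => z t - x i t)) => i; apply: measurable_vecB => //;
    exact: measurable_x.
- by apply: measurable_sqnorm; apply: measurable_vecB => //; exact: measurable_B.
Qed.
End measurability.

Local Notation L1 f := (P.-integrable setT (EFin \o f)).
Local Notation E f := (\int[P]_t f t).
Let V t := energy zs ws (z t) (w^~ t).
Let V' t := energy zs ws (z' t) (w'^~ t).
Let O t := residual B (z t) (w^~ t) (x^~ t) (y^~ t).
Let Dp := forward_noise_const L N1 N2 (sqnorm (B zs)).
Let De := sample_noise_const L N1 N2 N3 N4 (sqnorm (B zs)).
Let ctot := direction_const n tau L (\sum_i sqnorm (ws i)).

Variable fs : set (T -> R).
Hypothesis mfs : forall f, fs f -> measurable_fun setT f.
Hypothesis zfs : forall l, fs (fun t => z t ord0 l).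
Hypothesis wfs : forall i l, fs (fun t => w i t ord0 l).
Hypotheses (mp : measurable_vec eps) (me : measurable_vec e).
Hypothesis w_sum : forall t, \sum_i w i t = 0.
Hypothesis p0 : forall l, cond_exp_zero P (gen_sigma fs) (fun t => eps t ord0 l).
Hypothesis e0 : forall l, cond_exp_zero P (gen_sigma fs) (fun t => e t ord0 l).
Hypothesis pN : (\int[P]_t (sqnorm (eps t))%:E
  <= \int[P]_t (N1 + N2 * sqnorm (B (z t)))%:E)%E.
Hypothesis eN : (\int[P]_t (sqnorm (e t))%:E
  <= \int[P]_t (N3 + N4 * sqnorm (B (x ord_max t)))%:E)%E.
Hypothesis iV : L1 V.

Let mz : measurable_vec z. Proof. by move=> l; exact: mfs. Qed.
Let mw i : measurable_vec (w i). Proof. by move=> l; exact: mfs. Qed.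

Let EV_ge0 : 0 <= E V.
Proof. by apply: Rintegral_ge0 => t _; exact: energy_ge0. Qed.

Let Dp_ge0 : 0 <= Dp.
Proof.
apply: addr_ge0 => //; apply: mulr_ge0 => //.
by have := sqr_ge0 L; have := sqnorm_ge0 (B zs); lra.
Qed.

Lemma eps_moment : L1 (fun t => sqnorm (eps t)) /\
  E (fun t => sqnorm (eps t)) <= Dp * (1 + E V).
Proof.
have [iB EB] : L1 (fun t => sqnorm (B (z t))) /\ E (fun t => sqnorm (B (z t)))
    <= 2 * L ^+ 2 * E V + 2 * sqnorm (B zs).
  apply: integrable_affine_bound => //.
  - by apply: measurable_sqnorm; exact: measurable_B.
  - by move=> t; exact: sqnorm_ge0.
  - by move=> t; exact: B_bound.
have iR : L1 (fun t => N1 * 1 + N2 * sqnorm (B (z t))).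
  by apply: (@integrable_lin _ _ _ _ _ _ (fun=> 1)) => //; exact: integrable_prob_cst.
have [ip Ep] := @integrable_integral_le _ _ _ P (fun t => sqnorm (eps t))
  (fun t => N1 * 1 + N2 * sqnorm (B (z t)))
  (measurable_sqnorm mp) (fun t => sqnorm_ge0 _) iR
  ltac:(by under [X in (_ <= X)%E]eq_integral do rewrite mulr1).
split=> //; apply: le_trans Ep _.
rewrite (@Rintegral_lin _ _ _ _ _ _ (fun=> 1))//; last exact: integrable_prob_cst.
rewrite Rintegral_prob_cst mulr1.
have := ler_wpM2l N2_ge0 EB; rewrite /Dp /forward_noise_const.
have : 0 <= N1 * E V by rewrite mulr_ge0.
have : 0 <= N2 * L ^+ 2 by rewrite mulr_ge0 ?sqr_ge0.
have : 0 <= N2 * sqnorm (B zs) * E V by rewrite !mulr_ge0 ?sqnorm_ge0.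
lra.
Qed.

(** The point x_{n+1} depends on eps, so the bound on |B x_{n+1}|^2 by V + |eps|^2 has to be
    combined with the moment of eps. *)
Lemma e_moment : L1 (fun t => sqnorm (e t)) /\
  E (fun t => sqnorm (e t)) <= De * (1 + E V).
Proof.
have [ip Ep] := eps_moment.
have iVp : L1 (fun t => 1 * V t + 1 * sqnorm (eps t)) by exact: integrable_lin.
have EVp : E (fun t => 1 * V t + 1 * sqnorm (eps t)) = E V + E (fun t => sqnorm (eps t)).
  by rewrite Rintegral_lin// !mul1r.
have [iB] : L1 (fun t => sqnorm (B (x ord_max t))) /\ E (fun t => sqnorm (B (x ord_max t)))
    <= 2 * L ^+ 2 * forward_const L * E (fun t => 1 * V t + 1 * sqnorm (eps t))
       + 2 * sqnorm (B zs).
  apply: integrable_affine_bound => //.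
  - by apply: measurable_sqnorm; apply: measurable_B; exact: measurable_x.
  - by move=> t; exact: sqnorm_ge0.
  - by move=> t; rewrite !mul1r; exact: (@forward_B_bound _ _ _ _ _ _ _ L0 BL Bws rho (z t) (eps t) (w^~ t) (x^~ t)
      rho0 rho1 (xB t)).
rewrite EVp => EB.
have iR : L1 (fun t => N3 * 1 + N4 * sqnorm (B (x ord_max t))).
  by apply: (@integrable_lin _ _ _ _ _ _ (fun=> 1)) => //; exact: integrable_prob_cst.
have [ie Ee] := @integrable_integral_le _ _ _ P (fun t => sqnorm (e t))
  (fun t => N3 * 1 + N4 * sqnorm (B (x ord_max t)))
  (measurable_sqnorm me) (fun t => sqnorm_ge0 _) iR
  ltac:(by under [X in (_ <= X)%E]eq_integral do rewrite mulr1).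
split=> //; apply: le_trans Ee _.
rewrite (@Rintegral_lin _ _ _ _ _ _ (fun=> 1))//; last exact: integrable_prob_cst.
rewrite Rintegral_prob_cst mulr1.
have c0 : 0 <= 2 * L ^+ 2 * forward_const L.
  by rewrite /forward_const; have := sqr_ge0 L; nra.
have h1 : E (fun t => sqnorm (B (x ord_max t))) <=
   (2 * L ^+ 2 * forward_const L * (1 + Dp) + 2 * sqnorm (B zs)) * (1 + E V).
  apply: le_trans EB _; rewrite [leRHS]mulrDl; apply: lerD.
    rewrite -[leRHS]mulrA ler_wpM2l//; move: Ep; move: (E V) EV_ge0 => v v0.
    by move: Dp => q; lra.
  by rewrite ler_peMr ?lerDl// mulr_ge0 ?sqnorm_ge0.
have := ler_wpM2l N4_ge0 h1; rewrite /De /sample_noise_const -/Dp.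
have : 0 <= N3 * E V by rewrite mulr_ge0.
lra.
Qed.

(** The pathwise inequality is integrated. The terms linear in the noise vanish, and every remaining
    error carries alpha rho^2 or alpha^2, hence rho^4. *)
Lemma expected_iteration c : c <= (2 * tau)^-1 -> c <= tau / 2 -> c <= 2^-1 -> 0 < c ->
  [/\ L1 V', L1 O &
    E V' + 2 * Cf * c * rho ^+ 3 * E O
    <= E V + growth_const n tau L Cf N1 N2 N3 N4 (sqnorm (B zs)) (\sum_i sqnorm (ws i))
             * rho ^+ 4 * (1 + E V)].
Proof.
move=> c1 c2 c3 c0.
have a0 : 0 < alpha by rewrite mulr_gt0 ?exprn_gt0.
have [ip Ep] := eps_moment; have [ie Ee] := e_moment.
(* Measurability of b and u is established for the sigma-algebra generated by [fs], not merely for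
   that of T; this is what lets them be pulled out against eps and e. *)
pose F := g_sigma_algebraType (preimage_sets fs).
have mzF : @measurable_vec R _ F d z by move=> l; exact: measurable_gen_sigma.
have mwF i : @measurable_vec R _ F d (w i) by move=> l; exact: measurable_gen_sigma.
pose b t := B (z t) - w ord_max t; pose u t := z t - zs.
have mbF : @measurable_vec R _ F d b.
  apply: measurable_vecB => //.
  apply: (measurable_vec_lipschitz (C := L ^+ 2) mzF) => t t'.
  exact: lipschitz_sqnorm.
have muF : @measurable_vec R _ F d u.
  by apply: measurable_vecB => //; exact: measurable_vec_cst.
have [ib _] : L1 (fun t => sqnorm (b t)) /\
    E (fun t => sqnorm (b t)) <= (2 * L ^+ 2 + 2) * E V + 0.
  apply: integrable_affine_bound => //.
  - by apply: measurable_sqnorm; apply: measurable_vecB => //; exact: measurable_B.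
  - by move=> t; exact: sqnorm_ge0.
  - by move=> t; rewrite addr0; exact: residual_B_bound.
have [iu _] : L1 (fun t => sqnorm (u t)) /\ E (fun t => sqnorm (u t)) <= 1 * E V + 0.
  apply: integrable_affine_bound => //.
  - apply: measurable_sqnorm; apply: measurable_vecB => //; exact: measurable_vec_cst.
  - by move=> t; exact: sqnorm_ge0.
  - move=> t; rewrite addr0 mul1r; have := sqnorm_le_energy zs ws (z t) (w^~ t) ord_max.
    by have := sqnorm_ge0 (w ord_max t - ws ord_max); rewrite /u /V; lra.
have [ipb pb0] := cond_exp_zero_dotv mfs p0 mbF ip ib.
have [ieu eu0] := cond_exp_zero_dotv mfs e0 muF ie iu.
have Epb : E (fun t => dotv (eps t) (b t)) = 0 by rewrite /Rintegral pb0.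
have Eeu : E (fun t => dotv (e t) (u t)) = 0 by rewrite /Rintegral eu0.
have [mz' mw'] := measurable_step mz mw me mp.
have mV' : measurable_fun setT V' by exact: measurable_energy.
have mO : measurable_fun setT O by exact: measurable_residual.
(* The right-hand side of [one_iteration] is split into m0 (constant and V), m1 (linear noise, mean
   zero) and m2 (squared noise). *)
pose k := alpha ^+ 2 * ctot.
pose m0 := fun t => k * 1 + (1 + k) * V t.
pose m1 := fun t => (- (2 * alpha * rho * (1 - 2 * (rho * L)))) * dotv (eps t) (b t)
                    + (- (2 * alpha)) * dotv (e t) (u t).
pose m2 := fun t => (2 * alpha * rho ^+ 2 * L + k) * sqnorm (eps t) + k * sqnorm (e t).
have im0 : L1 m0 by apply: (@integrable_lin _ _ _ _ _ _ (fun=> 1)) => //;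
  exact: integrable_prob_cst.
have im1 : L1 m1 by exact: integrable_lin.
have im2 : L1 m2 by exact: integrable_lin.
pose m01 := fun t => 1 * m0 t + 1 * m1 t.
have im01 : L1 m01 by exact: integrable_lin.
pose m := fun t => 1 * m01 t + 1 * m2 t.
have im : L1 m by exact: integrable_lin.
have Em : E m = k + (1 + k) * E V
    + (2 * alpha * rho ^+ 2 * L + k) * E (fun t => sqnorm (eps t))
    + k * E (fun t => sqnorm (e t)).
  have -> : E m = 1 * E m01 + 1 * E m2 := Rintegral_lin 1 1 im01 im2.
  have -> : E m01 = 1 * E m0 + 1 * E m1 := Rintegral_lin 1 1 im0 im1.
  have -> : E m0 = k * E (fun=> 1) + (1 + k) * E V.
    exact: (Rintegral_lin k (1 + k) (integrable_prob_cst P 1) iV).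
  have -> : E m1 = 0.
    have := Rintegral_lin (- (2 * alpha * rho * (1 - 2 * (rho * L)))) (- (2 * alpha)) ipb ieu.
    by rewrite Epb Eeu !mulr0 addr0.
  have -> : E m2 = (2 * alpha * rho ^+ 2 * L + k) * E (fun t => sqnorm (eps t))
                   + k * E (fun t => sqnorm (e t)) by exact: (Rintegral_lin _ _ ip ie).
  by rewrite Rintegral_prob_cst !mul1r mulr1 !addr0 !addrA.
have step t : V' t + 2 * alpha * c * rho * O t <= m t.
  rewrite /V' zE (_ : w'^~ t = fun i => w i t - alpha *: (x i t - n.+1%:R^-1 *: \sum_j x j t));
    last exact/funext.
  apply: le_trans (@one_iteration _ _ _ _ _ _ _ _ _ mA L0 mB BL t0 Aws Bws ws0 rho
    (z t) (eps t) (e t) (w^~ t) (x^~ t) (y^~ t) rho0 rho1 rhoL (xA t) (xB t) (yB t) _ _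
    c1 c2 c3 (ltW c0) (ltW a0) (w_sum t)) _.
  by rewrite /m /m01 /m0 /m1 /m2 /k /V -/ctot; lra.
have V'0 t : 0 <= V' t by exact: energy_ge0.
have O0 t : 0 <= O t by exact: residual_ge0.
have q0 : 0 < 2 * alpha * c * rho by rewrite !mulr_gt0.
(* V' and O are nonnegative and the integrable m bounds V' plus a positive multiple of O, so each is
   integrable. *)
have [iV' _] : L1 V' /\ E V' <= 1 * E m + 0.
  apply: integrable_affine_bound => // t; rewrite mul1r addr0.
  by apply: le_trans (step t); rewrite lerDl mulr_ge0// ltW.
have [iO _] : L1 O /\ E O <= (2 * alpha * c * rho)^-1 * E m + 0.
  apply: integrable_affine_bound => // t; rewrite addr0 ler_pdivlMl//.
  by apply: le_trans (step t); rewrite lerDr.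
split=> //.
have : E (fun t => 1 * V' t + 2 * alpha * c * rho * O t) <= E m.
  apply: le_Rintegral => //; first exact: integrable_lin.
  by move=> t _; rewrite mul1r.
have -> : E (fun t => 1 * V' t + 2 * alpha * c * rho * O t)
    = 1 * E V' + 2 * alpha * c * rho * E O := Rintegral_lin _ _ iV' iO.
rewrite mul1r Em.
rewrite /growth_const -/Dp -/De -/ctot.
have k0 : 0 <= k.
  rewrite mulr_ge0 ?sqr_ge0// /ctot /direction_const /backward_const /forward_const.
  have S0 : 0 <= \sum_i sqnorm (ws i) by apply: sumr_ge0 => i _; exact: sqnorm_ge0.
  rewrite !(addr_ge0, mulr_ge0, exprn_ge0, invr_ge0, ler0n)//; try exact: ltW.
have h1 := ler_wpM2l k0 Ep; have h2 := ler_wpM2l k0 Ee.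
have al0 : 0 <= 2 * alpha * rho ^+ 2 * L by rewrite !mulr_ge0 ?exprn_ge0// ltW.
have h3 := ler_wpM2l al0 Ep.
have -> : 2 * Cf * c * rho ^+ 3 = 2 * alpha * c * rho by rewrite /alpha; ring.
have -> : (2 * Cf * L * Dp + Cf ^+ 2 * ctot * (1 + Dp + De)) * rho ^+ 4 * (1 + E V)
  = 2 * alpha * rho ^+ 2 * L * (Dp * (1 + E V)) + k * (Dp * (1 + E V))
    + k * (De * (1 + E V)) + k * (1 + E V) by rewrite /k /alpha; ring.
lra.
Qed.
End expected_iteration.

(** * Summation over the iterations and size of the stepsize *)

(** Over at most K steps the growth factor (1 + c / K)^k stays below exp c, so the v_k are bounded
    independently of K. Telescoping then adds K errors of size c / K times that bound. *)
Lemma discrete_gronwall (R : realType) (K : nat) (v o : nat -> R) (b c : R) :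
  (0 < K)%N -> 0 <= c -> 0 <= b -> (forall k, 0 <= v k) -> (forall k, 0 <= o k) ->
  (forall k, (1 <= k <= K)%N -> v k.+1 + b * o k <= v k + c * K%:R^-1 * (1 + v k)) ->
  b * \sum_(1 <= k < K.+1) o k <= v 1%N + c * (expR c * (1 + v 1%N)).
Proof.
move=> K0 c0 b0 v0 o0 step.
have K0' : (0 : R) < K%:R by rewrite ltr0n.
have q0 : 0 <= c * K%:R^-1 by rewrite mulr_ge0// invr_ge0 ltW.
have growth k : (k <= K)%N -> 1 + v k.+1 <= (1 + c * K%:R^-1) ^+ k * (1 + v 1%N).
  elim: k => [_|k IH kK]; first by rewrite expr0 mul1r.
  have := step k.+1 kK; have := mulr_ge0 b0 (o0 k.+1).
  have := ler_wpM2l (addr_ge0 ler01 q0) (IH (ltnW kK)).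
  by rewrite exprS -mulrA; lra.
have bound k : (k <= K)%N -> 1 + v k.+1 <= expR c * (1 + v 1%N).
  move=> kK; apply: le_trans (growth k kK) _; rewrite ler_wpM2r ?addr_ge0//.
  apply: (@le_trans _ _ (expR (c * K%:R^-1) ^+ k)).
    by rewrite lerXn2r ?nnegrE ?addr_ge0 ?expR_ge0 ?expR_ge1Dx.
  rewrite -expRM_natl ler_expR mulrCA -[leRHS]mulr1 ler_wpM2l//.
  by rewrite ler_pdivrMr// mul1r ler_nat.
have telescope k : (k <= K)%N -> b * (\sum_(1 <= j < k.+1) o j) + v k.+1
    <= v 1%N + k%:R * (c * K%:R^-1 * (expR c * (1 + v 1%N))).
  elim: k => [_|k IH kK]; first by rewrite big_geq// mulr0 mul0r add0r addr0.
  rewrite big_nat_recr//= mulrDr -natr1 mulrDl mul1r.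
  have := IH (ltnW kK); have := step k.+1 kK.
  by have := ler_wpM2l q0 (bound k (ltnW kK)); lra.
have := telescope K (leqnn K); have := v0 K.+1.
rewrite mulrA (mulrCA K%:R) divff ?gt_eqF// mulr1; lra.
Qed.

(** Since k = K^{-1/4} <= 1, capping the stepsize at 1 / (2 L) costs only a factor independent of K:
    rho lies between min(1, 1 / (2 L)) k and k. *)
Lemma rho_step_bounds (R : realType) (K : nat) (L : R) : (0 < K)%N -> 0 < L ->
  let k := K%:R `^ (- 4^-1) in let rho := rho_step K L in
  [/\ 0 < k, k ^+ 4 = K%:R^-1, 0 < rho, rho <= k & k <= 1] /\
  rho * L <= 2^-1 /\ Num.min 1 (2 * L)^-1 * k <= rho.
Proof.
move=> K0 L0 k rho.
have K1 : 1 <= K%:R :> R by rewrite ler1n.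
have k0 : 0 < k by rewrite powR_gt0// ltr0n.
have k4 : k ^+ 4 = K%:R^-1.
  rewrite -powR_mulrn ?(ltW k0)// /k -powRrM.
  by rewrite mulNr mulVf// powR_inv1// ler0n.
have k1 : k <= 1.
  by rewrite -(@expr_le1 _ 4)// ?(ltW k0)// k4 invf_le1// ltr0n.
have L20 : 0 < (2 * L)^-1 by rewrite invr_gt0 mulr_gt0.
split; [split=> //|split].
- by rewrite /rho /rho_step lt_min k0.
- by rewrite /rho /rho_step ge_min lexx.
- apply: (@le_trans _ _ ((2 * L)^-1 * L)).
    by rewrite ler_wpM2r ?(ltW L0)// /rho /rho_step ge_min lexx orbT.
  by rewrite invfM -mulrA mulVf ?mulr1// gt_eqF.
- rewrite /rho /rho_step le_min; apply/andP; split.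
    by rewrite ler_piMl ?(ltW k0)// ge_min lexx.
  apply: (@le_trans _ _ ((2 * L)^-1 * k)).
    by rewrite ler_wpM2r ?(ltW k0)// ge_min lexx orbT.
  by rewrite ler_piMr// ltW.
Qed.

(** * The convergence rate *)

Unset Implicit Arguments.

Theorem theorem2 (R : realType) (n d : nat) (hn : (1 <= n)%N) (hd : (1 <= d)%N)
  (A : 'I_n -> 'rV[R]_d -> set 'rV[R]_d) (hA : forall i, maximal_monotone (A i))
  (B : 'rV[R]_d -> 'rV[R]_d) (L : R) (hL : 0 < L)
  (hBmon : monotone_fun B) (hBlip : lipschitz_fun B L)
  (hsol : exists (zs : 'rV[R]_d) (a : 'I_n -> 'rV[R]_d),
            (forall i, A i zs (a i)) /\ \sum_(i < n) a i + B zs = 0)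
  (tau : R) (htau : 0 < tau) (Cf : R) (hCf : 0 < Cf)
  (z1 : 'rV[R]_d) (w1 : 'I_n.+1 -> 'rV[R]_d) (hw1 : \sum_(i < n.+1) w1 i = 0)
  (N1 N2 N3 N4 : R) (hN1 : 0 <= N1) (hN2 : 0 <= N2) (hN3 : 0 <= N3) (hN4 : 0 <= N4) :
  exists C : R,
  forall (K : nat), (1 <= K)%N ->
  forall (dm : measure_display) (Omega : measurableType dm) (P : probability Omega R)
    (z : nat -> Omega -> 'rV[R]_d)
    (w x y : nat -> 'I_n.+1 -> Omega -> 'rV[R]_d)
    (eps e : nat -> Omega -> 'rV[R]_d),
  let rho := rho_step K L in
  let alpha := Cf * rho ^+ 2 in
  (* initial point p^1 *)
  (forall om, z 1%N om = z1) ->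
  (forall i om, w 1%N i om = w1 i) ->
  (* noises are random variables *)
  (forall k (l : 'I_d), measurable_fun setT (fun om => eps k om ord0 l)) ->
  (forall k (l : 'I_d), measurable_fun setT (fun om => e k om ord0 l)) ->
  (* Algorithm SPS, for k = 1, ..., K *)
  (forall k, (1 <= k <= K)%N -> forall om,
     (forall (i : 'I_n.+1) (hi : (i < n)%N),
        let t := z k om + tau *: w k i om in
        (* x_i^k = J_{tau A_i}(t_i^k) = (I + tau A_i)^{-1}(t_i^k) *)
        (exists a, A (Ordinal hi) (x k i om) a /\ t = x k i om + tau *: a) /\
        y k i om = tau^-1 *: (t - x k i om)) /\
     (let r := B (z k om) + eps k om in
      x k ord_max om = z k om - rho *: (r - w k ord_max om) /\
      y k ord_max om = B (x k ord_max om) + e k om) /\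
     z k.+1 om = z k om - alpha *: \sum_(i < n.+1) y k i om /\
     (forall i, w k.+1 i om =
        w k i om - alpha *: (x k i om - (n.+1)%:R^-1 *: \sum_(j < n.+1) x k j om))) ->
  (* noise assumptions, for k = 1, ..., K *)
  (forall k, (1 <= k <= K)%N ->
     (forall l : 'I_d, cond_exp_zero P (Fk z w k) (fun om => eps k om ord0 l)) /\
     (forall l : 'I_d, cond_exp_zero P (Fk z w k) (fun om => e k om ord0 l)) /\
     cond_exp_le P (Fk z w k) (fun om => sqnorm (eps k om))
                               (fun om => N1 + N2 * sqnorm (B (z k om))) /\
     cond_exp_le P (FEk z w eps k) (fun om => sqnorm (e k om))
                               (fun om => N3 + N4 * sqnorm (B (x k ord_max om)))) ->
  let O := fun k om =>
    \sum_(i < n.+1 | (i < n)%N) sqnorm (y k i om - w k i om)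
    + \sum_(i < n.+1 | (i < n)%N) sqnorm (z k om - x k i om)
    + sqnorm (B (z k om) - w k ord_max om) in
  ((K%:R^-1)%:E * (\sum_(1 <= j < K.+1) \int[P]_om (O j om)%:E)
     <= (C * K%:R `^ (- 4^-1))%:E)%E.
Proof.
have [zs [a [Aa aB]]] := hsol.
(* For i < n, [insub] recovers the index in ['I_n]; the default [B zs] is the value at [ord_max]. *)
pose ws (i : 'I_n.+1) := oapp a (B zs) (insub (i : nat)).
have wsA (i : 'I_n.+1) (hi : (i < n)%N) : ws i = a (Ordinal hi) by rewrite /ws insubT.
have Bws : ws ord_max = B zs by rewrite /ws insubF//= ltnn.
have Aws (i : 'I_n.+1) (hi : (i < n)%N) : A (Ordinal hi) zs (ws i) by rewrite wsA.
have ws0 : \sum_i ws i = 0.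
  rewrite big_ord_recr/= Bws -[RHS]aB; congr (_ + _); apply: eq_bigr => i _.
  by rewrite (wsA (widen_ord (leqnSn n) i) (ltn_ord i)); congr a; exact: val_inj.
pose c := Num.min (Num.min (2 * tau)^-1 (tau / 2)) 2^-1.
have c0 : 0 < c by rewrite !lt_min !invr_gt0 (mulr_gt0 _ htau)// (divr_gt0 htau)//=.
have c1 : c <= (2 * tau)^-1 by rewrite !ge_min lexx.
have c2 : c <= tau / 2 by rewrite !ge_min lexx orbT.
have c3 : c <= 2^-1 by rewrite !ge_min lexx !orbT.
pose m := Num.min 1 (2 * L)^-1.
have m0 : 0 < m by rewrite lt_min ltr01 invr_gt0 mulr_gt0.
pose G := growth_const n tau L Cf N1 N2 N3 N4 (sqnorm (B zs)) (\sum_i sqnorm (ws i)).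
pose v1 := energy zs ws z1 w1.
pose D := v1 + `|G| * (expR `|G| * (1 + v1)).
(* D is the Gronwall bound on 2 Cf c rho^3 sum_k E O_k, and m comes from rho >= m K^{-1/4}; none of
   them involves K. *)
exists (D / (2 * Cf * c * m ^+ 3)).
move=> K K0 dm Omega P z w x y eps e rho alpha z1E w1E mp me alg noise.
pose O j t := residual B (z j t) ((w j)^~ t) ((x j)^~ t) ((y j)^~ t).
change (((K%:R^-1)%:E * (\sum_(1 <= j < K.+1) \int[P]_t (O j t)%:E)
  <= (D / (2 * Cf * c * m ^+ 3) * K%:R `^ (- 4^-1))%:E)%E).
have [[k0 k4 rho0 rhok k1] [rhoL rhom]] := @rho_step_bounds R K L K0 hL.
rewrite -/rho in rho0 rhok rhoL rhom.
set k := K%:R `^ _ in k0 k4 rhok k1 rhom *.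
have rho1 : rho <= 1 by exact: le_trans k1.
have mA i : monotone_op (A i) := (hA i).1.
have xA j : (1 <= j <= K)%N -> forall t (i : 'I_n.+1) (hi : (i < n)%N),
    A (Ordinal hi) (x j i t) (y j i t)
    /\ z j t + tau *: w j i t = x j i t + tau *: y j i t.
  move=> jK t i hi; have [/(_ i hi)[[b [Ab Eb]] Ey] _] := alg j jK t.
  have -> : y j i t = b.
    (* The y of the algorithm is the very element of A_i(x_i) that witnesses the resolvent. *)
    by rewrite Ey Eb addrC addKr scalerA mulVf ?scale1r// gt_eqF.
  by split.
have xB j : (1 <= j <= K)%N -> forall t,
    x j ord_max t = z j t - rho *: (B (z j t) + eps j t - w j ord_max t).
  by move=> jK t; have [_ [[-> _] _]] := alg j jK t.
have yB j : (1 <= j <= K)%N -> forall t,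
    y j ord_max t = B (x j ord_max t) + e j t.
  by move=> jK t; have [_ [[_ ->] _]] := alg j jK t.
have zE j : (1 <= j <= K)%N -> forall t, z j.+1 t = z j t - alpha *: \sum_i y j i t.
  by move=> jK t; have [_ [_ [-> _]]] := alg j jK t.
have wE j : (1 <= j <= K)%N -> forall t i,
    w j.+1 i t = w j i t - alpha *: (x j i t - n.+1%:R^-1 *: \sum_l x j l t).
  by move=> jK t i; have [_ [_ [_ ->]]] := alg j jK t.
have meas j : (1 <= j <= K.+1)%N ->
    measurable_vec (z j) /\ forall i, measurable_vec (w j i).
  elim: j => [//|[|j] IH] /= jK.
    split=> [|i]; [rewrite (_ : z 1%N = cst z1)|rewrite (_ : w 1%N i = cst (w1 i))];
      by [exact: measurable_vec_cst|apply/funext].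
  have [mz mw] := IH (ltnW jK).
  exact: (measurable_step mA hL hBlip htau (xA j.+1 jK) (xB j.+1 jK) (yB j.+1 jK)
    (zE j.+1 jK) (wE j.+1 jK) mz mw (me _) (mp _)).
have wsum j : (1 <= j <= K.+1)%N -> forall t, \sum_i w j i t = 0.
  elim: j => [//|[|j] IH] /= jK t.
    by rewrite -[RHS]hw1; apply: eq_bigr => i _; exact: w1E.
  exact: (sum_w_step (wE j.+1 jK) (IH (ltnW jK) t)).
pose V j t := energy zs ws (z j t) ((w j)^~ t).
have step j : (1 <= j <= K)%N -> P.-integrable setT (EFin \o V j) ->
    [/\ P.-integrable setT (EFin \o V j.+1), P.-integrable setT (EFin \o O j) &
      \int[P]_t V j.+1 t + 2 * Cf * c * rho ^+ 3 * \int[P]_t O j t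
      <= \int[P]_t V j t + G * rho ^+ 4 * (1 + \int[P]_t V j t)].
  move=> jK iV; have [j1 j2] := andP jK.
  have [p0 [e0 [pN eN]]] := noise j jK.
  have jK' : (1 <= j <= K.+1)%N by rewrite j1 leqW.
  have mfs f : Fk_gens z w j f -> measurable_fun setT f.
    move=> [i [/andP[i1 ij] fi]].
    have [mz mw] := meas i ltac:(by rewrite i1 (leq_trans ij)// leqW).
    by case: fi => [[l ->]|[h [l ->]]]; [exact: mz|exact: mw].
  have zfs l : Fk_gens z w j (fun t => z j t ord0 l).
    by exists j; split; [rewrite j1 leqnn|left; exists l].
  have wfs i l : Fk_gens z w j (fun t => w j i t ord0 l).
    by exists j; split; [rewrite j1 leqnn|right; exists i, l].
  (* Only the whole space is used as test set for the second moments, which makes the bounds on eps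
     and e unconditional. *)
  have {}pN := pN _ (@measurableT _ (g_sigma_algebraType (preimage_sets (Fk_gens z w j)))).
  have {}eN := eN _ (@measurableT _
    (g_sigma_algebraType (preimage_sets (Fk_gens z w j `|` coords (eps j))))).
  exact: (expected_iteration mA hL hBmon hBlip htau hCf Aws Bws ws0 hN1 hN2 hN3 hN4
    rho0 rho1 rhoL (xA _ jK) (xB _ jK) (yB _ jK) (zE _ jK) (wE _ jK) mfs zfs wfs
    (mp j) (me j) (wsum _ jK') p0 e0 pN eN iV c1 c2 c3 c0).
have V1 : V 1%N = cst v1.
  apply/funext => t; rewrite /V /v1 z1E; congr (energy _ _ _ _).
  exact/funext.
(* The initial energy is constant, and each step hands integrability on to the next. *)
have iV j : (1 <= j <= K.+1)%N -> P.-integrable setT (EFin \o V j).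
  elim: j => [//|[|j] IH] /= jK; first by rewrite V1; exact: integrable_prob_cst.
  by have [] := step j.+1 jK (IH (ltnW jK)).
have iO j : (1 <= j <= K)%N -> P.-integrable setT (EFin \o O j).
  move=> /andP[j1 j2]; have [] := step j ltac:(by rewrite j1) (iV j ltac:(by rewrite j1 leqW)).
  by [].
have K0' : (0 : R) < K%:R by rewrite ltr0n.
have rho4 : rho ^+ 4 <= K%:R^-1 by rewrite -k4 lerXn2r// nnegrE ltW.
have EV0 j : 0 <= \int[P]_t V j t by apply: Rintegral_ge0 => t _; exact: energy_ge0.
have EO0 j : 0 <= \int[P]_t O j t by apply: Rintegral_ge0 => t _; exact: residual_ge0.
have b0 : 0 < 2 * Cf * c * rho ^+ 3 by rewrite !mulr_gt0// exprn_gt0.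
have := @discrete_gronwall R K (fun j => \int[P]_t V j t) (fun j => \int[P]_t O j t)
  (2 * Cf * c * rho ^+ 3) `|G| K0 (normr_ge0 _) (ltW b0) EV0 EO0.
have -> : \int[P]_t V 1%N t = v1 by rewrite V1 Rintegral_prob_cst.
have gron j : (1 <= j <= K)%N ->
    \int[P]_t V j.+1 t + 2 * Cf * c * rho ^+ 3 * \int[P]_t O j t
    <= \int[P]_t V j t + `|G| * K%:R^-1 * (1 + \int[P]_t V j t).
  move=> jK; have [j1 j2] := andP jK.
  have [_ _ h] := step j jK (iV j ltac:(by rewrite j1 leqW)).
  apply: le_trans h _; rewrite lerD2l ler_wpM2r ?addr_ge0//.
  apply: (@le_trans _ _ (`|G| * rho ^+ 4)).
    by rewrite ler_wpM2r ?ler_norm// exprn_ge0 ?ltW.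
  by rewrite ler_wpM2l.
move=> /(_ gron); rewrite -/D => sumO.
have D0 : 0 <= D.
  by apply: le_trans sumO; rewrite mulr_ge0 ?(ltW b0)// sumr_ge0.
have -> : (\sum_(1 <= j < K.+1) \int[P]_om (O j om)%:E)%E
    = (\sum_(1 <= j < K.+1) \int[P]_t O j t)%:E.
  rewrite -sumEFin; apply: eq_big_nat => j /andP[j1 j2].
  by rewrite EFin_Rintegral//; apply: iO; rewrite j1.
rewrite -EFinM lee_fin ler_pdivrMl//.
have : K%:R^-1 * \sum_(1 <= j < K.+1) \int[P]_t O j t <= k ^+ 4 * (D / (2 * Cf * c * rho ^+ 3)).
  by rewrite k4 ler_wpM2l ?invr_ge0 ?(ltW K0')// ler_pdivlMr// mulrC.
rewrite ler_pdivrMl// => h; apply: le_trans h _.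
rewrite ler_wpM2l ?(ltW K0')//.
have b1 : 0 < 2 * Cf * c * (m * k) ^+ 3 by rewrite !mulr_gt0// exprn_gt0// mulr_gt0.
(* With 1 / K = k^4 and rho >= m k, the average is at most a constant times k^4 / k^3 = k. *)
apply: (@le_trans _ _ (k ^+ 4 * (D / (2 * Cf * c * (m * k) ^+ 3)))).
  rewrite ler_wpM2l ?exprn_ge0 ?(ltW k0)// ler_wpM2l// lef_pV2 ?posrE//.
  rewrite ler_wpM2l ?mulr_ge0 ?(ltW hCf) ?(ltW c0)// lerXn2r// nnegrE ltW// mulr_gt0//.
rewrite le_eqVlt; apply/orP; left; apply/eqP; field.
by rewrite !gt_eqF.
Qed.
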